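(* For every integer $n\ge 5$, $$15^{n/5}\le T(n)\le c^n\sqrt{n}\,n!,$$ where $c=\sqrt{\frac{3-\sqrt3}{6}}\,e^{\sqrt3/6}\approx 0.61354$.
   Context: A latin square of order $n$ is an $n\times n$ array of $n$ symbols in which each symbol occurs exactly once in each row and column. A transversal is a set of $n$ cells, one from each row and one from each column, no two containing the same symbol. $T(n)$ denotes the maximum, over all latin squares of order $n$, of the number of transversals of the square. *)

(* Defs.v *)
From mathcomp Require Import all_boot.
Set Implicit Arguments. Unset Strict Implicit. Unset Printing Implicit Defensive.

Definition latin_square (n : nat) (L : {ffun 'I_n * 'I_n -> 'I_n}) : bool :=
  [forall i : 'I_n, forall s : 'I_n, #|[set j : 'I_n | L (i, j) == s]| == 1] &&
  [forall j : 'I_n, forall s : 'I_n, #|[set i : 'I_n | L (i, j) == s]| == 1].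

Definition transversal (n : nat) (L : {ffun 'I_n * 'I_n -> 'I_n})
    (X : {set 'I_n * 'I_n}) : bool :=
  [&& #|X| == n,
      [forall i : 'I_n, #|[set c in X | c.1 == i]| == 1],
      [forall j : 'I_n, #|[set c in X | c.2 == j]| == 1] &
      [forall c1 in X, forall c2 in X, (L c1 == L c2) ==> (c1 == c2)]].

Definition num_transversals (n : nat) (L : {ffun 'I_n * 'I_n -> 'I_n}) : nat :=
  #|[set X : {set 'I_n * 'I_n} | transversal L X]|.

Definition T (n : nat) : nat :=
  \max_(L : {ffun 'I_n * 'I_n -> 'I_n} | latin_square L) num_transversals L.

(* Main.v *)
(* Upper bound: for a set W of cells let a(W) be the number of transversals containing W and M(W) the number of
   cells sharing no row, column or symbol with a cell of W. The normalized entropies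
   s_k = (sum of a(W) ln a(W) over |W| = k) / C(n,k) run from s_0 = T ln T to s_n = 0. For a transversal X, a cell
   outside X conflicts with exactly three cells of X, so the mean of M(W)/(n-k) over the k-subsets W of X is
   A_k = 1 + (n-k-1)(n-k-2)/(n-2); convexity of x ln x gives s_k - s_{k+1} <= T ln A_k, hence T <= prod_k A_k.
   That product is compared with c^n sqrt(n) n! through its consecutive ratios; n = 5 needs a refinement.

   Lower bound: for odd a and b <= 2a, take the order 3 block pattern with diagonal blocks any square of order a and
   off-diagonal blocks Z_a, and prolong it along b off-diagonal transversals. The result has order 3a + b and
   disjoint subsquares of orders a, a, a, b on its diagonal, so at least t(a)^3 t(b) transversals. Every n >= 20 is
   reached from orders 5,...,19. *)
Require Import Defs.
From Stdlib Require Import Reals Lra Lia ZArith.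
From HB Require Import structures.
From mathcomp Require all_boot ssralg zmodp zify.

(** * Transversals of Latin squares given by tables *)

Module Tables.
Import all_boot ssralg zmodp zify Defs.
Set Implicit Arguments. Unset Strict Implicit. Unset Printing Implicit Defensive.

Section Tables.
Variables (I : finType) (g : I -> I -> I).

(** On a finite type, injective rows and columns already make every symbol occur once in each. The
    index type is arbitrary, so sums and products of orders need no renumbering before
    [table_with_card]. *)
Definition latin_table := (forall i, injective (g i)) /\ (forall j, injective (g^~ j)).

(** A transversal is stored as the permutation sending each row to its column, not as a set of
    cells. *)
Definition table_transversals :=
  [set s : {ffun I -> I} | injectiveb s && injectiveb (fun i => g i (s i))].

Lemma table_transversalsP (s : {ffun I -> I}) :
  reflect (injective s /\ injective (fun i => g i (s i))) (s \in table_transversals).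
Proof. by rewrite inE; apply: (iffP andP) => -[/injectiveP ? /injectiveP]. Qed.

End Tables.

Definition table_with n K :=
  exists2 g : 'I_n -> 'I_n -> 'I_n, latin_table g & K <= #|table_transversals g|.

Lemma table_with_le_T n K : table_with n K -> K <= T n.
Proof.
case=> g [rowI colI] /leq_trans; apply.
pose L := [ffun c : 'I_n * 'I_n => g c.1 c.2].
have latin : latin_square L.
  apply/andP; split; apply/forallP=> i; apply/forallP=> s; apply/cards1P.
    exists (invF (rowI i) s); apply/setP=> j; rewrite !inE ffunE /=.
    by rewrite (canF_eq (invF_f (rowI i))).
  exists (invF (colI i) s); apply/setP=> j; rewrite !inE ffunE /=.
  by rewrite (canF_eq (invF_f (colI i))).
apply: leq_trans (leq_bigmax_cond L latin).
pose graph (s : {ffun 'I_n -> 'I_n}) := [set (i, s i) | i : 'I_n].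
have graphE s i j : ((i, j) \in graph s) = (j == s i).
  by apply/imsetP/eqP => [[i' _ [-> ->]]|->] //; exists i.
have graph_inj : injective graph.
  by move=> s t E; apply/ffunP=> i; apply/eqP; rewrite -graphE -E graphE.
rewrite -(card_imset _ graph_inj); apply: subset_leq_card.
apply/subsetP=> _ /imsetP[s /table_transversalsP[sI gI] ->]; rewrite inE.
apply/and4P; split.
- by rewrite card_imset ?card_ord // => i i' [].
- apply/forallP=> i; apply/cards1P; exists (i, s i); apply/setP=> -[i' j].
  rewrite !inE graphE /= xpair_eqE andbC.
  by case: eqP => // ->.
- apply/forallP=> j; apply/cards1P; exists (invF sI j, j); apply/setP=> -[i' j'].
  rewrite !inE graphE /= xpair_eqE -(canF_eq (invF_f sI)) andbC.
  by case: (j' =P j) => [->|]; rewrite ?andbF // !andbT eq_sym.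
- apply/forall_inP=> -[i j]; rewrite graphE => /eqP->.
  apply/forall_inP=> -[i' j']; rewrite graphE => /eqP->.
  by rewrite !ffunE /=; apply/implyP=> /eqP/gI->.
Qed.

Lemma table_with_card (I : finType) (g : I -> I -> I) n K : #|I| = n ->
  latin_table g -> K <= #|table_transversals g| -> table_with n K.
Proof.
move=> <- [rowI colI] /leq_trans cK.
exists (fun i j => enum_rank (g (enum_val i) (enum_val j))).
  split=> [i j j' /enum_rank_inj/rowI|j i i' /enum_rank_inj/colI] /enum_val_inj //.
apply: cK; pose h (s : {ffun I -> I}) : {ffun 'I_#|I| -> 'I_#|I|} := [ffun i => enum_rank (s (enum_val i))].
have hI : injective h.
  move=> s t /ffunP E; apply/ffunP=> i; have := E (enum_rank i).
  by rewrite !ffunE enum_rankK => /enum_rank_inj.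
rewrite -(card_imset _ hI); apply: subset_leq_card.
apply/subsetP=> _ /imsetP[s /table_transversalsP[sI gI] ->].
apply/table_transversalsP; split=> [i j|i j].
  by rewrite !ffunE => /enum_rank_inj/sI/enum_val_inj.
by rewrite !ffunE !enum_rankK => /enum_rank_inj/gI/enum_val_inj.
Qed.

(* Prolongation: the cells of the pairwise disjoint transversals [tr j] of [B] receive the new symbols [j],
   and the symbols they held move to the new column and to the new row [j]. *)
Section Prolongation.
Variables (A J : finType) (B : A -> A -> A) (k : J -> J -> J) (tr : J -> A -> A).
Hypotheses (latB : latin_table B) (latk : latin_table k).
Hypothesis tr_inj : forall j, injective (tr j).
Hypothesis trB_inj : forall j, injective (fun x => B x (tr j x)).
Hypothesis tr_disj : forall x, injective (tr^~ x).

Definition prolong (r c : A + J) : A + J :=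
  match r, c with
  | inl x, inl y => if [pick j | tr j x == y] is Some j then inr j else inl (B x y)
  | inl x, inr j => inl (B x (tr j x))
  | inr j, inl y => inl (B (invF (@tr_inj j) y) y)
  | inr i, inr j => inr (k i j)
  end.

Lemma prolong_latin : latin_table prolong.
Proof.
have [rowB colB] := latB; have [rowk colk] := latk.
(* Eight goals for the rows, then eight for the columns. A clash between an old column [y] and a new
   column [j] in row [x] would force [y = tr j x], which [pick] has excluded. *)
split=> [[x|i] [y|j] [y'|j'] | [y|j] [x|i] [x'|i']] /=.
- case: pickP => [j /eqP<- | nj]; case: pickP => [j' /eqP<- //| nj'] //.
    by case=> ->.
  by case=> /rowB->.
- case: pickP => // nj [/rowB E]; by have := nj j'; rewrite E eqxx.
- case: pickP => // nj [/rowB E]; by have := nj j; rewrite E eqxx.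
- by case=> /rowB/tr_disj->.
- case=> E; have /trB_inj : B (invF (@tr_inj i) y) (tr i (invF (@tr_inj i) y)) =
      B (invF (@tr_inj i) y') (tr i (invF (@tr_inj i) y')) by rewrite !f_invF.
  by move=> /(congr1 (tr i)); rewrite !f_invF => ->.
- by [].
- by [].
- by case=> /rowk->.
- case: pickP => [j /eqP e | nj]; case: pickP => [j' /eqP e' //| nj'] //.
    by case=> E; move: e'; rewrite -E -e => /tr_inj->.
  by case=> /colB->.
- case: pickP => // nj [/colB E]; have := nj i'.
  by rewrite E f_invF eqxx.
- case: pickP => // nj [/colB E]; have := nj i.
  by rewrite -E f_invF eqxx.
- case=> /colB E; congr inr; apply: (tr_disj (x := invF (@tr_inj i) y)).
  by rewrite f_invF E f_invF.
- by case=> /trB_inj->.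
- by [].
- by [].
- by case=> /colk->.
Qed.

(** A transversal of [B] avoiding every [tr j] uses only cells that keep their symbols, so it
    combines with any transversal of the corner subsquare [k]. *)
Lemma prolong_transversals (K : nat) :
  K <= #|[set s in table_transversals B | [forall j, forall x, tr j x != s x]]| ->
  K * #|table_transversals k| <= #|table_transversals prolong|.
Proof.
move=> /leq_mul/(_ (leqnn _))/leq_trans; apply; rewrite -cardsX.
pose glue (u : {ffun A -> A} * {ffun J -> J}) : {ffun A + J -> A + J} :=
  [ffun c => match c with inl x => inl (u.1 x) | inr j => inr (u.2 j) end].
have glueI : injective glue.
  move=> [s u] [s' u'] /ffunP E; congr (_, _); apply/ffunP=> x.
    by have := E (inl x); rewrite !ffunE => -[].
  by have := E (inr x); rewrite !ffunE => -[].
rewrite -(card_imset _ glueI); apply: subset_leq_card.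
apply/subsetP=> _ /imsetP[[s u] /setXP[/setIdP[sB /forallP off] uk] ->].
have [[sI BI] [uI kI]] := (table_transversalsP _ _ sB, table_transversalsP _ _ uk).
have hE x : prolong (inl x) (inl (s x)) = inl (B x (s x)).
  by rewrite /=; case: pickP => // j; have /forallP/(_ x)/negPf-> := off j.
apply/table_transversalsP; split=> -[x|j] [x'|j']; rewrite !ffunE //=.
- by case=> /sI->.
- by case=> /uI->.
- by rewrite -!/(prolong (inl _) (inl _)) !hE => -[/BI->].
- by rewrite -/(prolong (inl _) (inl _)) hE.
- by rewrite -/(prolong (inl _) (inl _)) hE.
- by case=> /kI->.
Qed.

End Prolongation.

Import GRing.Theory.
Local Open Scope ring_scope.

(** The residue of [x + x] is even without wraparound and odd with it, since the modulus is odd;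
    hence it determines [x]. *)
Lemma double_inj a : odd a.+1 -> injective (fun x : 'I_a.+1 => x + x).
Proof.
have E z : (z <= a -> (z + z) %% a.+1 = (if z + z <= a then z + z else z + z - a.+1))%N.
  move=> za; case: leqP => zz; first by rewrite modn_small.
  by rewrite -{1}(subnK zz) modnDr modn_small; lia.
move=> a_odd x y /(congr1 (@nat_of_ord _)) /=; have := odd_double_half a.+1.
rewrite a_odd !E; [|exact: (ltn_ord y)|exact: (ltn_ord x)] => m_odd xy.
apply: val_inj => /=; move: m_odd xy.
by case: (leqP (x + x) a) => ?; case: (leqP (y + y) a) => ?; lia.
Qed.

(** * Three subsquares on the diagonal of the order 3 block pattern *)

Section Tripling.
Variables (a : nat) (J : finType) (theta : J -> bool * 'I_a.+1).
Variables (g : 'I_a.+1 -> 'I_a.+1 -> 'I_a.+1) (k : J -> J -> J).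
Hypotheses (latg : latin_table g) (latk : latin_table k).
Hypothesis theta_inj : injective theta.
Hypothesis dbl_inj : J -> injective (fun x : 'I_a.+1 => x + x).

(** The blocks follow the idempotent square [- (p + q)] on Z_3: since [- (p + p) = p], the diagonal
    block [p] is a subsquare on the symbols [(p, _)]. *)
Definition tripled (u v : 'I_3 * 'I_a.+1) :=
  if u.1 == v.1 then (u.1, g u.2 v.2) else (- (u.1 + v.1), u.2 + v.2).

Definition block_shift (e : bool) : 'I_3 := if e then inord 1 else inord 2.

(** [theta] labels each new symbol by a nonzero block shift and a translation of the cyclic group.
    Blocks of order m offer 2m labels. *)
Definition off_diagonal j (u : 'I_3 * 'I_a.+1) :=
  (u.1 + block_shift (theta j).1, u.2 + (theta j).2).

Let third (p q : 'I_3) : p != q -> - (p + q) != p.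
Proof. by case: p q => [[|[|[|//]]] ?] [[|[|[|//]]] ?]. Qed.

Lemma tripled_latin : latin_table tripled.
Proof.
have [rowg colg] := latg.
split=> [[p x] [q y] [r z] | [q y] [p x] [r z]]; rewrite /tripled /=.
- case: eqVneq => [<-|pq]; case: eqVneq => [<-|pr].
  + by move=> /pair_equal_spec[_ /rowg->].
  + by move=> /pair_equal_spec[/esym/eqP]; rewrite (negPf (third pr)).
  + by move=> /pair_equal_spec[/eqP]; rewrite (negPf (third pq)).
  + move=> /pair_equal_spec[H1 H2]; by rewrite (addrI _ (oppr_inj H1)) (addrI _ H2).
- case: eqVneq => [->|pq]; case: eqVneq => [->|rq] //.
  + by move=> /pair_equal_spec[_ /colg->].
  + by move=> /pair_equal_spec[/esym/eqP]; rewrite addrC (negPf (third _)) // eq_sym.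
  + by move=> /pair_equal_spec[/eqP]; rewrite addrC (negPf (third _)) // eq_sym.
  + move=> /pair_equal_spec[H1 H2]; by rewrite (addIr _ (oppr_inj H1)) (addIr _ H2).
Qed.

Lemma block_shift_neq0 e (p : 'I_3) : (p == p + block_shift e) = false.
Proof.
rewrite eq_sym -subr_eq0 addrC addKr.
by case: e; rewrite /block_shift -val_eqE /= inordK.
Qed.

Lemma off_diagonal_inj j : injective (off_diagonal j).
Proof. by move=> [p x] [q y] /pair_equal_spec[/addIr /= -> /addIr /= ->]. Qed.

Lemma off_diagonal_disj u : injective (off_diagonal^~ u).
Proof.
move=> i j /pair_equal_spec[/addrI E /addrI E2]; apply: theta_inj.
rewrite (surjective_pairing (theta i)) (surjective_pairing (theta j)) E2.
congr (_, _); move: E; case: (_.1); case: (_.1) => //.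
  by move=> /(congr1 (@nat_of_ord _)); rewrite /block_shift !inordK.
by move=> /(congr1 (@nat_of_ord _)); rewrite /block_shift !inordK.
Qed.

(** Up to constants the symbol met in row [(p, x)] is minus twice [p] and twice [x], so doubling
    must be injective in both coordinates. This is where odd order enters. *)
Lemma tripled_off_diagonal_inj j :
  injective (fun u => tripled u (off_diagonal j u)).
Proof.
move=> [p x] [q y]; rewrite /tripled /off_diagonal /= !block_shift_neq0.
move=> /pair_equal_spec[/oppr_inj]; rewrite !addrA => /addIr pq /addIr xy.
rewrite (dbl_inj j xy); congr (_, _).
by move: pq; exact: (@double_inj 2 isT).
Qed.

(** Three transversals of [g], one per diagonal block, form a transversal; it misses [off_diagonal],
    whose cells have different row and column blocks. *)
Lemma tripled_transversals :
  (#|table_transversals g| ^ 3 <=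
  #|[set s in table_transversals tripled |
      [forall j, forall u, off_diagonal j u != s u]]|)%N.
Proof.
pose D := [set f : {ffun 'I_3 -> {ffun 'I_a.+1 -> 'I_a.+1}} | f \in ffun_on (mem (table_transversals g))].
have -> : (#|table_transversals g| ^ 3 = #|D|)%N.
  by rewrite -[X in (_ ^ X)%N](card_ord 3) -card_ffun_on; apply: eq_card => f; rewrite !inE.
pose glue (f : {ffun 'I_3 -> {ffun 'I_a.+1 -> 'I_a.+1}}) :
  {ffun 'I_3 * 'I_a.+1 -> 'I_3 * 'I_a.+1} := [ffun u => (u.1, f u.1 u.2)].
have glueI : injective glue.
  move=> f f' /ffunP E; apply/ffunP=> p; apply/ffunP=> x.
  by have := E (p, x); rewrite !ffunE => -[].
rewrite -(card_imset _ glueI); apply: subset_leq_card.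
apply/subsetP=> _ /imsetP[f fS ->].
have fD : ffun_on (mem (table_transversals g)) f by rewrite inE in fS.
move/ffun_onP: fD => fD.
rewrite inE; apply/andP; split; last first.
  apply/forallP=> j; apply/forallP=> -[p x]; rewrite !ffunE /off_diagonal /=.
  by rewrite xpair_eqE eq_sym block_shift_neq0.
apply/table_transversalsP; split=> -[p x] [q y]; rewrite !ffunE /tripled /= ?eqxx.
  case=> <-; have /table_transversalsP[sI _] := fD p.
  by move=> /sI->.
case=> <-; have /table_transversalsP[_ gI] := fD p.
by move=> /gI->.
Qed.

End Tripling.
Local Close Scope ring_scope.

Lemma table_with_triple a b K1 K2 : 0 < a -> b <= a.*2 -> odd a || (b == 0) ->
  table_with a K1 -> table_with b K2 -> table_with (3 * a + b) (K1 ^ 3 * K2).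
Proof.
case: a => // a _ ba ab [g latg gK] [k latk kK].
pose theta (j : 'I_b) : bool * 'I_a.+1 := (j < a.+1, inord (if j < a.+1 then j : nat else j - a.+1)).
have theta_inj : injective theta.
  have lt (i : 'I_b) : (if i < a.+1 then i : nat else i - a.+1) < a.+1.
    by case: (ltnP i a.+1) => //; have := ltn_ord i; lia.
  move=> i j /pair_equal_spec[E /(congr1 (@nat_of_ord _))]; rewrite !inordK // => H.
  by apply: val_inj => /=; move: E H; case: (ltnP i a.+1); case: (ltnP j a.+1) => //; lia.
have dbl : 'I_b -> injective (fun x : 'I_a.+1 => x + x)%R.
  case/orP: ab => [ao _|/eqP b0]; first exact: double_inj.
  by move=> [j]; rewrite b0.
apply: (@table_with_card _ (prolong (tripled g) k (@off_diagonal_inj a _ theta))).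
- by rewrite card_sum card_prod !card_ord.
- apply: prolong_latin => //; first exact: tripled_latin.
    exact: tripled_off_diagonal_inj.
  exact: off_diagonal_disj.
- apply: leq_trans (prolong_transversals _ _ (tripled_transversals theta g)).
  by rewrite leq_mul // leq_exp2r.
Qed.

End Tables.

(** * Latin squares of small order *)

Module SmallOrders.
Import all_boot zify Defs Tables.
Set Implicit Arguments. Unset Strict Implicit. Unset Printing Implicit Defensive.

(** In a group table, right multiplication by [v] after [s] gives another transversal. If [s] fixes
    [e], the value at [e] recovers [v], so no translate is counted twice. *)
Lemma translate_transversals (I : finType) (g : I -> I -> I) (e : I)
    (S : {set {ffun I -> I}}) :
  latin_table g -> associative g -> left_id e g ->
  S \subset table_transversals g -> {in S, forall s : {ffun I -> I}, s e = e} ->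
  #|I| * #|S| <= #|table_transversals g|.
Proof.
move=> [rowg colg] gA ge sS Se.
pose tr (p : I * {ffun I -> I}) := [ffun x => g (p.2 x) p.1].
have trI : {in setX [set: I] S &, injective tr}.
  move=> [v s] [w t] /setXP[_ Ss] /setXP[_ St] /ffunP E.
  have := E e; rewrite !ffunE /= !Se // !ge => vw.
  by congr (_, _) => //; apply/ffunP=> x; have := E x; rewrite !ffunE /= vw => /colg.
rewrite -cardsT -cardsX -(card_in_imset trI); apply: subset_leq_card.
apply/subsetP=> _ /imsetP[[v s] /setXP[_ Ss] ->].
have /table_transversalsP[sI gI] := subsetP sS _ Ss.
apply/table_transversalsP; split=> x y; rewrite !ffunE /=; first by move=> /colg/sI.
by rewrite !gA => /colg/gI.
Qed.

(** * Certificates as lists of numbers *)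

Section Lists.
Implicit Types (s t : seq nat) (tab : seq (seq nat)) (l : seq (seq nat)).

(** A list strictly increasing in this order has no repetition, and testing that only compares
    neighbours. *)
Fixpoint ltlex s t :=
  match s, t with
  | x :: s', y :: t' => (x < y) || (x == y) && ltlex s' t'
  | [::], _ :: _ => true
  | _, _ => false
  end.

Lemma ltlex_irr : irreflexive ltlex.
Proof. by elim=> //= x s ->; rewrite ltnn eqxx. Qed.

Lemma ltlex_trans : transitive ltlex.
Proof.
elim=> [|y t IH] [|x s] [|z u] //= /orP[xy|/andP[/eqP-> st]] /orP[yz|/andP[/eqP<- tu]].
- by rewrite (ltn_trans xy yz).
- by rewrite xy.
- by rewrite yz.
- by rewrite eqxx (IH _ _ st tu) orbT.
Qed.

Definition entry tab i j := nth 0 (nth [::] tab i) j.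

Definition table_of n (f : nat -> nat -> nat) := [seq [seq f i j | j <- iota 0 n] | i <- iota 0 n].

Definition row_ok n s := [&& size s == n, all (ltn^~ n) s & uniq s].

Definition latin_list n tab :=
  [&& size tab == n, all (row_ok n) tab &
      all (fun j => uniq [seq nth 0 r j | r <- tab]) (iota 0 n)].

Definition transversal_list n tab s :=
  row_ok n s && uniq [seq nth 0 p.1 p.2 | p <- zip tab s].

(** The condition on row 0 makes 0 a left neutral element, as [translate_transversals] requires
    besides associativity. *)
Definition group_list n tab :=
  (nth [::] tab 0 == iota 0 n) &&
  all (fun x => all (fun y => all (fun z =>
    entry tab (entry tab x y) z == entry tab x (entry tab y z))
    (iota 0 n)) (iota 0 n)) (iota 0 n).

Lemma iota_all n (P : pred nat) : all P (iota 0 n) -> forall i : 'I_n, P i.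
Proof. by move=> /allP H i; apply: H; rewrite mem_iota /=. Qed.

Section Table.
Variables (m : nat) (tab : seq (seq nat)).
Notation n := m.+1.
Hypothesis latin : latin_list n tab.

Definition ord_table (i j : 'I_n) : 'I_n := inord (entry tab i j).
Definition ord_fun s : {ffun 'I_n -> 'I_n} := [ffun i : 'I_n => inord (nth 0 s i)].

Let row_tab (i : 'I_n) : row_ok n (nth [::] tab i).
Proof.
have /and3P[/eqP sz /allP rows _] := latin.
by apply: rows; rewrite mem_nth ?sz.
Qed.

Lemma row_ok_lt s (i : 'I_n) : row_ok n s -> nth 0 s i < n.
Proof. by case/and3P=> /eqP sz /allP lt _; apply: lt; rewrite mem_nth ?sz. Qed.

Lemma ord_tableE i j : ord_table i j = entry tab i j :> nat.
Proof. by rewrite inordK // row_ok_lt. Qed.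

Lemma ord_funE s i : row_ok n s -> ord_fun s i = nth 0 s i :> nat.
Proof. by move=> ok; rewrite ffunE inordK // row_ok_lt. Qed.

Lemma ord_table_latin : latin_table ord_table.
Proof.
split=> [i j j'|j i i'] /(congr1 (@nat_of_ord _)); rewrite !ord_tableE.
  have /and3P[/eqP sz _ /uniqP-/(_ 0) u] := row_tab i.
  by move=> /u E; apply: val_inj; apply: E; rewrite inE sz.
have /and3P[/eqP sz _ cols] := latin.
have /uniqP-/(_ 0) u := iota_all cols j; rewrite size_map sz in u.
move=> E; apply: val_inj; apply: (u i i'); rewrite ?inE ?ltn_ord //.
by rewrite !(nth_map [::]) ?sz.
Qed.

Lemma ord_fun_transversal s : transversal_list n tab s ->
  ord_fun s \in table_transversals ord_table.
Proof.
case/andP=> ok us; have /and3P[/eqP sz _ /uniqP-/(_ 0) u] := ok.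
have /and3P[/eqP szt _ _] := latin.
apply/table_transversalsP; split=> i j /(congr1 (@nat_of_ord _)).
  by rewrite !ord_funE // => /u E; apply: val_inj; apply: E; rewrite inE sz.
rewrite !ord_tableE !ord_funE // => E; apply: val_inj.
have /uniqP-/(_ 0) uz := us; rewrite size_map size_zip szt sz minnn in uz.
apply: (uz i j); rewrite ?inE ?ltn_ord //.
by rewrite !(nth_map ([::], 0)) ?size_zip ?szt ?sz ?minnn // !nth_zip ?szt ?sz.
Qed.

Variable l : seq (seq nat).
Hypotheses (l_ok : all (transversal_list n tab) l) (l_sorted : sorted ltlex l).

Let S := [set f in [seq ord_fun s | s <- l]].

Let S_sub : S \subset table_transversals ord_table.
Proof.
apply/subsetP=> f; rewrite inE => /mapP[s ls ->].
by apply: ord_fun_transversal; apply: (allP l_ok).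
Qed.

Let card_S : #|S| = size l.
Proof.
rewrite cardsE -(size_map ord_fun l); apply/card_uniqP.
rewrite map_inj_in_uniq ?(sorted_uniq ltlex_trans ltlex_irr) //.
move=> s t /(allP l_ok)/andP[oks _] /(allP l_ok)/andP[okt _] /ffunP E.
have [/and3P[/eqP szs _ _] /and3P[/eqP szt _ _]] := (oks, okt).
apply: (@eq_from_nth _ 0) => [|i]; rewrite szs ?szt // => i_n.
by have /(congr1 (@nat_of_ord _)) := E (Ordinal i_n); rewrite !ord_funE.
Qed.

Lemma table_with_list : table_with n (size l).
Proof. by exists ord_table; [exact: ord_table_latin | rewrite -card_S subset_leq_card]. Qed.

Lemma table_with_group_list : group_list n tab -> all (fun s => nth 0 s 0 == 0) l ->
  table_with n (n * size l).
Proof.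
case/andP=> /eqP row0 tabA l0.
exists ord_table; first exact: ord_table_latin.
rewrite -card_S -[X in X * _]card_ord.
apply: (@translate_transversals _ _ ord0) => // [|x y z|x|f].
- exact: ord_table_latin.
- apply: val_inj => /=; rewrite !ord_tableE.
  by have /eqP-> := iota_all (iota_all (iota_all tabA x) y) z.
- by apply: val_inj; rewrite /= ord_tableE /entry row0 nth_iota.
- rewrite inE => /mapP[s ls ->]; apply: val_inj.
  by rewrite /= ord_funE ?(eqP (allP l0 s ls)) //; case/andP: (allP l_ok s ls).
Qed.

End Table.

Definition sortlex := sort (fun s t => ~~ ltlex t s).

(** [p.1] leads from new rows to old ones, [p.2] from old columns to new ones. *)
Definition act (p : seq nat * seq nat) s := [seq nth 0 p.2 (nth 0 s x) | x <- p.1].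

(* Row c of [sub] is the map y |-> y - c, so the result takes the value 0 at 0. *)
Definition normalize (sub : seq (seq nat)) s :=
  let r := nth [::] sub (nth 0 s 0) in [seq nth 0 r y | y <- s].

Definition check n tab l := [&& latin_list n tab, all (transversal_list n tab) l & sorted ltlex l].
Definition check_group n tab l :=
  [&& check n tab l, group_list n tab & all (fun s => nth 0 s 0 == 0) l].

Lemma table_with_check n tab l : check n.+1 tab l -> table_with n.+1 (size l).
Proof. by case/and3P=> *; apply: (@table_with_list _ tab). Qed.

Lemma table_with_check_group n tab l :
  check_group n.+1 tab l -> table_with n.+1 (n.+1 * size l).
Proof. by case/and3P=> /and3P[? ? ?] *; apply: (@table_with_group_list _ tab). Qed.

End Lists.

(** * Symmetries that generate the lists *)

Section Cyclic.
Variable n : nat.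
Let add x y := if x + y < n then x + y else x + y - n.
Definition cyc_table := table_of n add.
Definition cyc_sub := table_of n (fun c y => if c <= y then y - c else y + n - c).
(** Each pair turns [s] into i |-> w^(-1) s(t + w i), with [w] a unit of Z_n. *)
Definition cyc_autos (units : seq nat) :=
  flatten [seq let multiples := [seq iter i (add w) 0 | i <- iota 0 n] in
    let quotients := [seq index y multiples | y <- iota 0 n] in
    [seq ([seq add t z | z <- multiples], quotients) | t <- iota 0 n] | w <- units].
End Cyclic.

(* The base transversals below come from a random search. They are spread by autotopisms of the table, but no
   property of these maps is proved: [check] verifies that the resulting lists consist of distinct transversals. *)
Definition orbit_list sub autos bases :=
  sortlex (flatten [seq [seq normalize sub (act p s) | s <- bases] | p <- autos]).

(** The fifth power of 15^(n/5) <= K, kept in the naturals; it is multiplicative when 3a + b is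
    built from a and b. *)
Definition good_order n := exists2 K, table_with n K & 15 ^ n <= K ^ 5.

Lemma good_order_list n tab l k : check n.+1 tab l -> size l = k ->
  15 ^ n.+1 <= k ^ 5 -> good_order n.+1.
Proof. by move=> ok <-; exists (size l); [exact: table_with_check ok | ]. Qed.

Lemma good_order_group_list n tab l k : check_group n.+1 tab l -> size l = k ->
  15 ^ n.+1 <= (n.+1 * k) ^ 5 -> good_order n.+1.
Proof. by move=> ok <-; exists (n.+1 * size l); [exact: table_with_check_group ok | ]. Qed.

Lemma good_order_triple a b : 0 < a -> b <= a.*2 -> odd a ->
  good_order a -> good_order b -> good_order (3 * a + b).
Proof.
move=> a0 ba a_odd [K1 aK aE] [K2 bK bE]; exists (K1 ^ 3 * K2).
  by apply: table_with_triple => //; rewrite a_odd.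
have E : (K1 ^ 3) ^ 5 = (K1 ^ 5) ^ 3 by rewrite -!expnM.
by rewrite expnD [3 * a]mulnC expnM expnMn E leq_mul // leq_exp2r.
Qed.

Lemma good_order_triple0 a : 0 < a -> good_order a -> good_order (3 * a).
Proof.
move=> a0 [K1 aK aE]; exists (K1 ^ 3); last first.
  have E : (K1 ^ 3) ^ 5 = (K1 ^ 5) ^ 3 by rewrite -!expnM.
  by rewrite [3 * a]mulnC expnM E leq_exp2r.
rewrite -[3 * a]addn0 -[K1 ^ 3]muln1.
apply: table_with_triple => //; first by rewrite eqxx orbT.
(* The table of order 0 has one transversal, the empty function, so [b = 0] contributes a factor
   1. *)
exists (fun i _ => i); first by split=> [] [].
by apply/card_gt0P; exists [ffun i => i]; apply/table_transversalsP; split=> [] [].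
Qed.

(* The prolongation of (x, y) |-> 2 y - x on Z_m along its main diagonal, with m as the point at infinity. *)
Definition diag_table m := table_of m.+1 (fun x y =>
  if (x == m) && (y == m) then m else if x == m then y else if y == m then x
  else if x == y then m else (y.*2 + (m - x)) %% m).

(** The affine maps x |-> t + w x, fixing infinity, preserve [diag_table]. Each pair holds such a
    map and its inverse. *)
Definition diag_autos m (units : seq nat) :=
  flatten [seq let multiples := [seq (w * i) %% m | i <- iota 0 m] in
    [seq (rcons [seq (t + z) %% m | z <- multiples] m,
          rcons [seq index ((y + (m - t)) %% m) multiples | y <- iota 0 m] m)
     | t <- iota 0 m] | w <- units].

(** Makes [normalize] the identity, for tables without a group of translations. *)
Definition identity_sub n := [seq iota 0 n | i <- iota 0 n].

(** The number 6u + v stands for (u, v) in Z_2 x Z_6; a = 1 gives the sum of x and y, a = 5 the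
    difference. *)
Definition z2z6 a x y := (x %/ 6 + y %/ 6) %% 2 * 6 + (x %% 6 + a * (y %% 6)) %% 6.

Definition z2z6_autos := [seq ([seq z2z6 a t z | z <- iota 0 12], [seq z2z6 a 0 z | z <- iota 0 12])
  | t <- iota 0 12, a <- [:: 1; 5]].

(* Multiplication by a primitive element of the field with 16 elements. *)
Definition gf16_mul := [:: 0; 2; 4; 6; 8; 10; 12; 14; 3; 1; 7; 5; 11; 9; 15; 13].

Definition bit_xor x y := nat_of_bin (BinNat.N.lxor (bin_of_nat x) (bin_of_nat y)).

(** With r a primitive element, each pair turns [s] into z |-> r^i s(t + r^(-i) z). *)
Definition gf16_autos tab :=
  flatten [seq let power := iter i (fun p => [seq nth 0 gf16_mul y | y <- p]) (iota 0 16) in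
    [seq ([seq entry tab t (index z power) | z <- iota 0 16], power) | t <- iota 0 16] | i <- iota 0 15].

(** The lists are x |-> w x with w and w + 1 units. Their 15 translates meet the bound with
    equality. *)
Lemma good_order_5 : good_order 5.
Proof.
apply: (@good_order_group_list _ (cyc_table 5) [:: [:: 0; 1; 2; 3; 4]; [:: 0; 2; 4; 1; 3];
  [:: 0; 3; 1; 4; 2]] 3).
- by vm_compute.
- by [].
- lia.
Qed.

(** No group table of order 6 has a transversal, hence an explicit square. 26 is the least K with
    15^6 <= K^5. *)
Lemma good_order_6 : good_order 6.
Proof.
apply: (@good_order_list _ ([:: [:: 3; 4; 0; 2; 5; 1]; [:: 0; 5; 2; 4; 1; 3]; [:: 1; 2; 3; 5; 4; 0];
  [:: 2; 1; 4; 0; 3; 5]; [:: 5; 0; 1; 3; 2; 4]; [:: 4; 3; 5; 1; 0; 2]]) [:: [:: 0; 1; 4; 3; 2; 5];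
  [:: 0; 1; 5; 2; 4; 3]; [:: 0; 2; 3; 1; 5; 4]; [:: 0; 2; 4; 5; 1; 3]; [:: 0; 3; 1; 5; 2; 4];
  [:: 0; 3; 5; 1; 4; 2]; [:: 0; 4; 1; 3; 5; 2]; [:: 0; 4; 3; 2; 1; 5]; [:: 1; 0; 2; 5; 4; 3];
  [:: 1; 0; 3; 4; 2; 5]; [:: 1; 2; 0; 5; 3; 4]; [:: 1; 2; 5; 4; 0; 3]; [:: 1; 4; 2; 3; 0; 5];
  [:: 1; 4; 5; 0; 3; 2]; [:: 1; 5; 0; 3; 4; 2]; [:: 1; 5; 3; 0; 2; 4]; [:: 2; 3; 0; 5; 4; 1];
  [:: 2; 4; 1; 5; 3; 0]; [:: 2; 4; 3; 0; 5; 1]; [:: 2; 5; 3; 1; 4; 0]; [:: 3; 0; 4; 5; 2; 1];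
  [:: 3; 1; 5; 4; 2; 0]; [:: 3; 4; 2; 5; 1; 0]; [:: 3; 4; 5; 2; 0; 1]; [:: 4; 2; 0; 3; 5; 1];
  [:: 4; 2; 5; 1; 3; 0]] 26).
- by vm_compute.
- by [].
- lia.
Qed.

Lemma good_order_7 : good_order 7.
Proof.
apply: (@good_order_group_list _ (cyc_table 7) [:: [:: 0; 1; 2; 3; 4; 5; 6];
  [:: 0; 1; 3; 5; 2; 6; 4]; [:: 0; 1; 4; 2; 6; 3; 5]; [:: 0; 2; 3; 6; 4; 1; 5];
  [:: 0; 2; 4; 1; 5; 3; 6]; [:: 0; 2; 4; 5; 1; 6; 3]; [:: 0; 2; 4; 6; 1; 3; 5]] 7).
- by vm_compute.
- by [].
- lia.
Qed.

Lemma good_order_8 : good_order 8.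
Proof.
apply: (@good_order_group_list _ ([:: [:: 0; 1; 2; 3; 4; 5; 6; 7]; [:: 1; 0; 3; 2; 5; 4; 7; 6];
  [:: 2; 3; 0; 1; 6; 7; 4; 5]; [:: 3; 2; 1; 0; 7; 6; 5; 4]; [:: 4; 5; 6; 7; 0; 1; 2; 3];
  [:: 5; 4; 7; 6; 1; 0; 3; 2]; [:: 6; 7; 4; 5; 2; 3; 0; 1]; [:: 7; 6; 5; 4; 3; 2; 1; 0]])
  [:: [:: 0; 2; 4; 6; 3; 1; 7; 5]; [:: 0; 2; 4; 6; 5; 7; 1; 3]; [:: 0; 2; 5; 7; 1; 3; 4; 6];
  [:: 0; 2; 5; 7; 6; 4; 3; 1]; [:: 0; 2; 6; 4; 1; 3; 7; 5]; [:: 0; 2; 6; 4; 5; 7; 3; 1];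
  [:: 0; 2; 7; 5; 3; 1; 4; 6]; [:: 0; 2; 7; 5; 6; 4; 1; 3]; [:: 0; 3; 4; 7; 1; 2; 5; 6];
  [:: 0; 3; 4; 7; 5; 6; 1; 2]] 10).
- by vm_compute.
- by [].
- lia.
Qed.

(** 6 units times 9 translations give 54. In the later orders too, the size is the number of bases
    times the number of symmetries. *)
Lemma good_order_9 : good_order 9.
Proof.
pose bases := [:: [:: 0; 4; 1; 8; 3; 5; 2; 6; 7]].
apply: (@good_order_group_list _ (cyc_table 9)
  (orbit_list (cyc_sub 9) (cyc_autos 9 [:: 1; 2; 4; 5; 7; 8]) bases) 54).
- by vm_compute.
- by vm_compute.
- lia.
Qed.

Lemma good_order_11 : good_order 11.
Proof.
pose bases := [:: [:: 0; 9; 1; 5; 2; 7; 3; 8; 10; 4; 6]].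
apply: (@good_order_group_list _ (cyc_table 11) (orbit_list (cyc_sub 11) (cyc_autos 11 (iota 1 10)) bases) 110).
- by vm_compute.
- by vm_compute.
- lia.
Qed.

Lemma good_order_13 : good_order 13.
Proof.
pose bases := [:: [:: 0; 7; 8; 4; 5; 10; 11; 12; 3; 9; 6; 1; 2]].
apply: (@good_order_group_list _ (cyc_table 13) (orbit_list (cyc_sub 13) (cyc_autos 13 (iota 1 12)) bases) 156).
- by vm_compute.
- by vm_compute.
- lia.
Qed.

Lemma good_order_17 : good_order 17.
Proof.
pose bases := [:: [:: 0; 12; 9; 15; 5; 16; 8; 13; 4; 1; 14; 11; 3; 6; 2; 10; 7];
  [:: 0; 4; 14; 5; 8; 6; 13; 16; 7; 11; 3; 15; 9; 1; 10; 12; 2];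
  [:: 0; 5; 6; 16; 1; 4; 8; 14; 10; 7; 2; 9; 3; 11; 13; 15; 12]].
apply: (@good_order_group_list _ (cyc_table 17) (orbit_list (cyc_sub 17) (cyc_autos 17 (iota 1 16)) bases) 816).
- by vm_compute.
- by vm_compute.
- lia.
Qed.

Lemma good_order_19 : good_order 19.
Proof.
pose bases := [:: [:: 0; 7; 9; 18; 8; 4; 10; 6; 16; 11; 12; 14; 3; 13; 15; 2; 17; 1; 5];
  [:: 0; 6; 15; 11; 9; 4; 14; 18; 10; 2; 13; 1; 17; 3; 7; 12; 8; 5; 16];
  [:: 0; 2; 15; 5; 11; 6; 4; 9; 12; 17; 3; 14; 16; 8; 10; 18; 7; 1; 13];
  [:: 0; 1; 2; 17; 18; 10; 4; 11; 6; 7; 3; 14; 5; 15; 12; 16; 8; 13; 9];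
  [:: 0; 9; 7; 18; 14; 6; 2; 16; 5; 8; 12; 4; 13; 11; 17; 1; 10; 3; 15]].
apply: (@good_order_group_list _ (cyc_table 19) (orbit_list (cyc_sub 19) (cyc_autos 19 (iota 1 18)) bases) 1710).
- by vm_compute.
- by vm_compute.
- lia.
Qed.

(** Group tables of order 2 modulo 4 have no transversal, so orders 10 and 14 use prolonged
    squares. *)
Lemma good_order_10 : good_order 10.
Proof.
pose bases := [:: [:: 6; 4; 8; 7; 2; 1; 5; 3; 0; 9];
  [:: 7; 9; 5; 0; 2; 6; 4; 1; 8; 3];
  [:: 0; 6; 7; 8; 5; 9; 2; 3; 4; 1];
  [:: 1; 3; 5; 8; 2; 6; 0; 4; 7; 9];
  [:: 5; 1; 9; 8; 0; 6; 7; 2; 4; 3]].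
apply: (@good_order_list _ (diag_table 9)
  (orbit_list (identity_sub 10) (diag_autos 9 [:: 1; 2; 4; 5; 7; 8]) bases) 270).
- by vm_compute.
- by vm_compute.
- lia.
Qed.

Lemma good_order_14 : good_order 14.
Proof.
pose bases := [:: [:: 0; 3; 9; 5; 6; 1; 10; 8; 4; 12; 7; 2; 13; 11];
  [:: 4; 1; 12; 5; 8; 10; 3; 9; 11; 0; 13; 7; 2; 6];
  [:: 1; 13; 2; 11; 6; 8; 12; 5; 10; 3; 7; 9; 4; 0];
  [:: 0; 13; 1; 12; 8; 4; 5; 6; 7; 10; 3; 9; 11; 2];
  [:: 11; 9; 2; 4; 7; 8; 10; 13; 5; 1; 0; 3; 6; 12];
  [:: 5; 9; 4; 7; 2; 3; 6; 11; 1; 13; 0; 8; 10; 12];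
  [:: 9; 12; 4; 1; 2; 0; 11; 8; 5; 10; 7; 6; 3; 13];
  [:: 13; 5; 11; 1; 10; 12; 7; 2; 3; 9; 6; 8; 0; 4];
  [:: 4; 1; 0; 13; 2; 7; 10; 3; 6; 12; 8; 9; 11; 5];
  [:: 4; 8; 7; 2; 12; 11; 3; 6; 9; 1; 0; 10; 5; 13];
  [:: 0; 2; 3; 8; 7; 6; 12; 4; 5; 1; 9; 10; 13; 11];
  [:: 1; 3; 12; 8; 5; 6; 9; 2; 11; 0; 4; 7; 10; 13];
  [:: 10; 7; 5; 4; 0; 1; 11; 12; 3; 9; 8; 6; 13; 2]].
apply: (@good_order_list _ (diag_table 13) (orbit_list (identity_sub 14) (diag_autos 13 (iota 1 12)) bases) 2028).
- by vm_compute.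
- by vm_compute.
- lia.
Qed.

(** Cyclic tables of even order have no transversal; orders 12 and 16 use noncyclic groups. *)
Lemma good_order_12 : good_order 12.
Proof.
pose bases := [:: [:: 0; 2; 10; 6; 4; 8; 11; 1; 3; 7; 9; 5];
  [:: 0; 10; 3; 1; 8; 9; 4; 7; 11; 6; 5; 2];
  [:: 0; 3; 11; 5; 10; 7; 4; 8; 1; 2; 9; 6]].
apply: (@good_order_group_list _ (table_of 12 (z2z6 1))
  (orbit_list (table_of 12 (fun c y => z2z6 5 y c)) z2z6_autos bases) 72).
- by vm_compute.
- by vm_compute.
- lia.
Qed.

Lemma good_order_16 : good_order 16.
Proof.
pose bases := [:: [:: 0; 8; 13; 9; 7; 11; 1; 5; 14; 2; 15; 6; 4; 12; 10; 3];
  [:: 0; 14; 3; 5; 13; 8; 12; 2; 10; 7; 9; 15; 11; 1; 6; 4]].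
apply: (@good_order_group_list _ (table_of 16 bit_xor)
  (orbit_list (table_of 16 bit_xor) (gf16_autos (table_of 16 bit_xor)) bases) 480).
- by vm_compute.
- by vm_compute.
- lia.
Qed.

Lemma good_order_ge5 n : 5 <= n -> good_order n.
Proof.
elim/ltn_ind: n => n IH n5; have [n20|n20] := ltnP n 20.
  have [->|n15] := eqVneq n 15; first exact: (@good_order_triple0 5 isT good_order_5).
  have [->|n18] := eqVneq n 18; first exact: (@good_order_triple0 6 isT good_order_6).
  do 5![case: n n5 n20 n15 n18 IH => [//|n] n5 n20 n15 n18 IH].
  case: n {n5 IH} n20 n15 n18 => [|[|[|[|[|[|[|[|[|[|[|[|[|[|[|//]]]]]]]]]]]]]]] _ //= _ _.
  - exact: good_order_5.
  - exact: good_order_6.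
  - exact: good_order_7.
  - exact: good_order_8.
  - exact: good_order_9.
  - exact: good_order_10.
  - exact: good_order_11.
  - exact: good_order_12.
  - exact: good_order_13.
  - exact: good_order_14.
  - exact: good_order_16.
  - exact: good_order_17.
  - exact: good_order_19.
(* [a] is the odd one of [k] and [k - 1], so [n - 3 a] lies between 5 and 10, hence is at most
   [2 a]. *)
pose k := (n - 5) %/ 3; pose a := if odd k then k else k.-1.
have k5 : 5 <= k by rewrite /k; lia.
have a_odd : odd a by rewrite /a; case: ifP => // /negbT; case: (k) k5 => //= j _; rewrite negbK.
have ak : k.-1 <= a <= k by rewrite /a; case: ifP; lia.
have a5 : 5 <= a.
  by case: (ltnP a 5) => // a4; move: a_odd; rewrite (_ : a = 4) //; lia.
have kn : 3 * k <= n - 5 < 3 * k + 3 by rewrite /k; lia.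
rewrite (_ : n = 3 * a + (n - 3 * a)); last by lia.
apply: good_order_triple => //; [lia | lia | |]; apply: IH; lia.
Qed.

End SmallOrders.

(** * The entropy bound *)

Module Entropy.
Import all_boot zify Defs.
Set Implicit Arguments. Unset Strict Implicit. Unset Printing Implicit Defensive.

(** * Counting extensions in a family of conflict-free sets *)

Section Extensions.
Variables (C : finType) (n : nat) (F : {set {set C}}) (confl : rel C).
Hypothesis card_F : forall X, X \in F -> #|X| = n.
Hypothesis confl_refl : forall c, confl c c.
Hypothesis compat_F : forall X, X \in F ->
  {in X &, forall c d, confl c d -> c = d}.
Hypothesis confl_F : forall X d, X \in F -> d \notin X ->
  2 < #|[set c in X | confl c d]|.

(** This is a(W), and M(W) is the size of [avail W]. *)
Definition ext (W : {set C}) := #|[set X in F | W \subset X]|.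

Definition avail (W : {set C}) := [set d | [forall c in W, ~~ confl c d]].

(** Double counting of the pairs [W], [X] turns averages over all [W] into averages inside a fixed
    [X]. *)
Lemma sum_ext (f : {set C} -> nat) k :
  \sum_(W : {set C} | #|W| == k) ext W * f W =
  \sum_(X in F) \sum_(W : {set C} | (W \subset X) && (#|W| == k)) f W.
Proof.
rewrite (exchange_big_dep (fun W : {set C} => #|W| == k)) /=; last first.
  by move=> X W _ /andP[].
apply: eq_bigr => W Wk.
rewrite sum_nat_const /ext; congr (_ * _).
by apply: eq_card => X; rewrite !inE [RHS]unfold_in /= Wk andbT.
Qed.

Lemma sum_ext1 k : \sum_(W : {set C} | #|W| == k) ext W = #|F| * 'C(n, k).
Proof.
under eq_bigr do rewrite -[ext _]muln1.
rewrite sum_ext -sum_nat_const; apply: eq_bigr => X FX.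
by rewrite sum1dep_card cards_draws card_F.
Qed.

Lemma avail_sub (X W : {set C}) : X \in F -> W \subset X -> X :&: avail W = X :\: W.
Proof.
move=> FX sWX; apply/setP=> d; rewrite !inE andbC.
have [Xd|] := boolP (d \in X); rewrite ?andbF ?andbT //.
apply/forall_inP/idP => [noW | nWd c Wc].
  by apply/negP=> /noW; rewrite confl_refl.
apply: contra nWd => cd; rewrite -(compat_F FX _ Xd cd) //.
exact: subsetP sWX _ Wc.
Qed.

(** Each [X] containing [W] is counted once for each of its cells outside [W], all of them
    available. *)
Lemma sum_ext_setU1 (W : {set C}) :
  \sum_(d in avail W) ext (d |: W) = (n - #|W|) * ext W.
Proof.
transitivity (\sum_(d in avail W) \sum_(X in F | d |: W \subset X) 1).
  by apply: eq_bigr => d _; rewrite sum1dep_card.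
rewrite (exchange_big_dep [pred X in F | W \subset X]) /=; last first.
  by move=> d X _; rewrite subUset => /and3P[-> _ ->].
transitivity (\sum_(X in F | W \subset X) (n - #|W|)); last first.
  by rewrite sum_nat_const mulnC; congr (_ * _); apply: eq_card => X; rewrite !inE.
apply: eq_bigr => X /andP[FX sWX].
rewrite sum1dep_card -(card_F FX) -cardsDS // -(avail_sub FX sWX).
apply: eq_card => d.
by rewrite [in LHS]inE subUset sub1set FX sWX andbT /= in_setI andbC.
Qed.

Lemma sub_avail (X W : {set C}) d : W \subset X ->
  (d \in avail W) = (W \subset [set c in X | ~~ confl c d]).
Proof.
move=> sWX; rewrite inE; apply/forall_inP/subsetP => H c Wc.
  by rewrite inE (subsetP sWX) // H.
by have := H c Wc; rewrite inE => /andP[].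
Qed.

(** Fix [X]. A cell of [X] forbids at least itself to [W]; a cell outside forbids at least three
    cells of [X]. *)
Lemma sum_ext_avail k :
  \sum_(W : {set C} | #|W| == k) ext W * #|avail W| <=
  #|F| * (n * 'C(n.-1, k) + (#|C| - n) * 'C(n - 3, k)).
Proof.
rewrite sum_ext -sum_nat_const; apply: leq_sum => X FX.
under eq_bigr => W /andP[sWX _].
  rewrite -sum1_card. under eq_bigl => d do rewrite (sub_avail _ sWX).
  over.
rewrite (exchange_big_dep xpredT) //=.
have E d : \sum_(W : {set C} | ((W \subset X) && (#|W| == k)) &&
   (W \subset [set c in X | ~~ confl c d])) 1 =
  'C(#|[set c in X | ~~ confl c d]|, k).
  rewrite sum1dep_card -cards_draws; apply: eq_card => W; rewrite !inE.
  case sW: (W \subset [set c in X | ~~ confl c d]); rewrite ?andbF ?andbT //=.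
  suff -> : W \subset X by [].
  by apply: subset_trans sW _; apply/subsetP=> c; rewrite inE => /andP[].
under eq_bigr do rewrite E.
have D d : #|[set c in X | ~~ confl c d]| = n - #|[set c in X | confl c d]|.
  rewrite -(card_F FX) -cardsDS; last by apply/subsetP=> c; rewrite inE => /andP[].
  by apply: eq_card => c; rewrite !inE; case: (c \in X) => //=; rewrite andbT.
rewrite (bigID (mem X)) /=; apply: leq_add.
  rewrite -{1}(card_F FX) -sum_nat_const; apply: leq_sum => d Xd.
  rewrite D; apply: leq_bin2l; suff : 0 < #|[set c in X | confl c d]| by lia.
  by apply/card_gt0P; exists d; rewrite !inE Xd confl_refl.
rewrite -[X in (#|C| - X) * _](card_F FX) -(cardsC X) addKn -sum_nat_const.
rewrite [leqRHS](eq_bigl (fun d => d \notin X)); last by move=> d; rewrite inE.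
apply: leq_sum => d nXd; rewrite D; apply: leq_bin2l.
have := confl_F FX nXd; lia.
Qed.

End Extensions.

Local Open Scope R_scope.

HB.instance Definition _ := Monoid.isComLaw.Build R 0 Rplus
  (fun x y z => esym (Rplus_assoc x y z)) Rplus_comm Rplus_0_l.
HB.instance Definition _ := Monoid.isComLaw.Build R 1 Rmult
  (fun x y z => esym (Rmult_assoc x y z)) Rmult_comm Rmult_1_l.

Section RealSums.
Variables (I : finType) (P : pred I).

Lemma rsum_le (f g : I -> R) : (forall i, P i -> f i <= g i) ->
  \big[Rplus/0]_(i | P i) f i <= \big[Rplus/0]_(i | P i) g i.
Proof. by move=> fg; elim/big_ind2: _ => [||//]; [lra | move=> *; lra]. Qed.

Lemma rsum_mulr (f : I -> R) a :
  \big[Rplus/0]_(i | P i) (a * f i) = a * \big[Rplus/0]_(i | P i) f i.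
Proof. by elim/big_rec2: _ => [|i x y _ ->]; lra. Qed.

Lemma rsum_INR (f : I -> nat) :
  \big[Rplus/0]_(i | P i) INR (f i) = INR (\sum_(i | P i) f i).
Proof. by elim/big_rec2: _ => [//|i x y _ ->]; rewrite -plusE plus_INR. Qed.

End RealSums.

(** Each set of size k + 1 arises from k + 1 pairs, by removing one element. *)
Lemma rsum_setU1 (C : finType) (f : {set C} -> R) k :
  \big[Rplus/0]_(W : {set C} | #|W| == k) \big[Rplus/0]_(d | d \notin W) f (d |: W) =
  INR k.+1 * \big[Rplus/0]_(V : {set C} | #|V| == k.+1) f V.
Proof.
rewrite -rsum_mulr.
transitivity (\big[Rplus/0]_(V : {set C} | #|V| == k.+1) \big[Rplus/0]_(d in V) f V); last first.
  apply: eq_bigr => V /eqP <-; rewrite big_const.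
  by elim: #|_| => [|m IH]; rewrite ?S_INR ?iterS ?IH /=; lra.
rewrite (exchange_big_dep xpredT) //= [RHS](exchange_big_dep xpredT) //=.
apply: eq_bigr => d _.
rewrite (reindex_onto (fun V : {set C} => V :\ d) (fun W => d |: W)) /=; last first.
  by move=> W /andP[_ nWd]; rewrite setU1K.
apply: eq_big => [V|V /andP[/andP[_ _] /eqP->] //].
case Vd: (d \in V); last first.
  rewrite andbF; apply/negP=> /andP[_ /eqP E].
  by move: Vd; rewrite -E setU11.
by rewrite setD1K // eqxx !inE eqxx /= !andbT (cardsD1 d V) Vd.
Qed.

(** The tangent to x ln x at [b], from ln y <= y - 1 at y = b / a. *)
Lemma xlnx_ge (a b : R) : 0 <= a -> 0 < b -> a * ln b + a - b <= a * ln a.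
Proof.
case=> [a0|<-] b0; last lra.
have ba : 0 < b / a by apply: Rdiv_lt_0_compat.
have : ln (b / a) <= b / a - 1.
  by have := exp_ineq1_le (ln (b / a)); rewrite exp_ln //; lra.
rewrite /Rdiv ln_mult ?ln_Rinv //; last exact: Rinv_0_lt_compat.
move=> H; have : a * (ln b + - ln a) <= a * (b * / a - 1).
  by apply: Rmult_le_compat_l; lra.
by rewrite (_ : a * (b * / a - 1) = b - a); [lra | field; lra].
Qed.

(** * Entropies of the extension counts *)

Section Entropy.
Variables (C : finType) (n : nat) (F : {set {set C}}) (confl : rel C).
Hypothesis card_F : forall X, X \in F -> #|X| = n.
Hypothesis confl_refl : forall c, confl c c.
Hypothesis compat_F : forall X, X \in F ->
  {in X &, forall c d, confl c d -> c = d}.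
Hypothesis confl_F : forall X d, X \in F -> d \notin X ->
  (2 < #|[set c in X | confl c d]|)%N.
Hypothesis card_C : #|C| = (n * n)%N.
Hypothesis n3 : (2 < n)%N.

Notation ext := (ext F).
Notation avail := (avail confl).

Definition entropy (k : nat) :=
  \big[Rplus/0]_(W : {set C} | #|W| == k) (INR (ext W) * ln (INR (ext W))).

(* [mean_choices (n - k)] is A_k. *)
Definition mean_choices m := 1 + INR (m.-1 * m.-2) / INR (n - 2).

Lemma mean_choices_gt0 m : 0 < mean_choices m.
Proof.
have : 0 < INR (n - 2) by apply: lt_0_INR; lia.
move=> /Rinv_0_lt_compat H; rewrite /mean_choices /Rdiv.
by have := Rmult_le_pos _ _ (pos_INR (m.-1 * m.-2)) (Rlt_le _ _ H); lra.
Qed.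

Lemma sum_ext_avail_le k : (k < n)%N ->
  INR (\sum_(W : {set C} | #|W| == k) ext W * #|avail W|) <=
  INR #|F| * INR 'C(n, k) * INR (n - k) * mean_choices (n - k).
Proof.
move=> kn.
have /leP/le_INR := sum_ext_avail card_F confl_refl confl_F k.
(* Clearing the denominator [n - 2] leaves an identity of naturals; the absorption rule reduces
   every binomial to C(n, k). *)
suff E : ((n - 2) * (n * 'C(n.-1, k) + (#|C| - n) * 'C(n - 3, k)) =
    'C(n, k) * (n - k) * (n - 2 + (n - k).-1 * (n - k).-2))%N.
  have N2 : 0 < INR (n - 2) by apply: lt_0_INR; lia.
  move=> H; apply: Rle_trans H _; rewrite -multE mult_INR.
  apply: Req_le; move/(congr1 INR): E; rewrite -!multE -!plusE.
  set s := (n * _ + _)%coq_nat; rewrite !mult_INR plus_INR !mult_INR => E.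
  rewrite /mean_choices -multE mult_INR.
  apply: (Rmult_eq_reg_l (INR (n - 2))); last lra.
  by rewrite -Rmult_assoc (Rmult_comm (INR (n-2))) Rmult_assoc E; field; lra.
have b1 : (n * 'C(n.-1, k) = (n - k) * 'C(n, k))%N by exact: mul_bin_down.
have b2 : (n.-1 * 'C(n.-2, k) = (n.-1 - k) * 'C(n.-1, k))%N by exact: mul_bin_down.
have b3 : (n.-2 * 'C(n - 3, k) = (n.-2 - k) * 'C(n.-2, k))%N.
  by rewrite (_ : n - 3 = n.-2.-1)%N; [exact: mul_bin_down | lia].
rewrite card_C.
have -> : (n * n - n = n * n.-1)%N by case: (n) => //= *; nia.
have -> : (n - 2 = n.-2)%N by lia.
have -> : ((n - k).-2 = n.-2 - k)%N by lia.
have -> : ((n - k).-1 = n.-1 - k)%N by lia.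
rewrite mulnDr [in LHS]b1.
rewrite (_ : n.-2 * (n * n.-1 * 'C(n - 3, k)) = n * (n.-1 * (n.-2 * 'C(n - 3, k))))%N; last by nia.
rewrite b3 (mulnCA n.-1) b2 (mulnCA n) (mulnCA n) b1; nia.
Qed.

(** This is s_k - s_(k+1) <= T ln A_k with the binomials cleared. The right side becomes a sum over
    pairs [W], [d], each term bounded below by a tangent at a(W) / A_k. *)
Lemma entropy_step k : (k < n)%N ->
  INR (n - k) * (entropy k - INR #|F| * INR 'C(n, k) * ln (mean_choices (n - k)))
  <= INR k.+1 * entropy k.+1.
Proof.
move=> kn; set A := mean_choices _.
have A0 : 0 < A by exact: mean_choices_gt0.
rewrite -rsum_setU1.
pose f (W : {set C}) := INR (n - k) * (INR (ext W) * ln (INR (ext W))) +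
  (INR (n - k) * (1 - ln A) * INR (ext W) + - / A * INR (ext W * #|avail W|)).
apply: (@Rle_trans _ (\big[Rplus/0]_(W : {set C} | #|W| == k) f W)).
  rewrite !big_split /= !rsum_mulr !rsum_INR (sum_ext1 card_F).
  have := sum_ext_avail_le kn; rewrite -/A -/(entropy k).
  move=> /(Rmult_le_compat_l (/ A)) H.
  have {}H := H (Rlt_le _ _ (Rinv_0_lt_compat _ A0)).
  rewrite -multE mult_INR multE; move: H.
  set u := INR (\sum_(_ | _) _).
  rewrite (_ : / A * (_ * A) = INR #|F| * INR 'C(n, k) * INR (n - k)); last by field; lra.
  by rewrite Ropp_mult_distr_l_reverse; move: (/ A * u) => v; move: (INR _) (INR _) (INR _) (ln A) => *; lra.
apply: rsum_le => W /eqP Wk; rewrite /f.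
have ext_le d : (ext (d |: W) <= ext W)%N.
  apply: subset_leq_card; apply/subsetP=> X; rewrite !inE subUset.
  by move=> /and3P[-> _ ->].
have nonneg (a : nat) : 0 <= INR a * ln (INR a).
  case: a => [|a]; first by rewrite /=; lra.
  have := xlnx_ge (pos_INR a.+1) Rlt_0_1; have := pos_INR a.
  by rewrite ln_1 S_INR; lra.
have nav d : d \in avail W -> d \notin W.
  by rewrite inE => /forall_inP H; apply/negP=> /H; rewrite confl_refl.
(* Cells outside [avail W] contribute only nonnegative terms. *)
apply: (@Rle_trans _ (\big[Rplus/0]_(d in avail W) (INR (ext (d |: W)) * ln (INR (ext (d |: W)))))); last first.
  rewrite [X in _ <= X](bigID (mem (avail W))) /=.
  rewrite [X in _ <= X + _](eq_bigl (mem (avail W))); last first.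
    by move=> d /=; case av: (d \in avail W); rewrite ?andbF ?andbT // nav.
  have : 0 <= \big[Rplus/0]_(d | (d \notin W) && (d \notin avail W))
     (INR (ext (d |: W)) * ln (INR (ext (d |: W)))).
    elim/big_ind: _ => [|x y|d _]; [lra | move=> *; lra | exact: nonneg].
  by move: (bigop _ _ _) (bigop _ _ _) => *; lra.
(* The tangent point must be positive, so [ext W = 0] is treated apart. *)
have [e0|ne0] := eqVneq (ext W) 0%N.
  rewrite e0 mul0n /= (_ : _ + _ = 0); last lra.
  by elim/big_ind: _ => [|x y|d _]; [lra | move=> *; lra | exact: nonneg].
have e0 : 0 < INR (ext W) by apply: lt_0_INR; lia.
apply: (@Rle_trans _ (\big[Rplus/0]_(d in avail W)
    ((ln (INR (ext W)) - ln A + 1) * INR (ext (d |: W)) + INR (ext W) * - / A * 1))).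
  rewrite big_split /= !rsum_mulr rsum_INR (sum_ext_setU1 card_F confl_refl compat_F) Wk.
  rewrite (_ : \big[Rplus/0]_(d in avail W) 1 = INR #|avail W|); last first.
    by rewrite -sum1_card -(rsum_INR _ (fun=> 1%N)).
  by rewrite -!multE !mult_INR; lra.
(* This tangent to x ln x serves both the log-sum inequality at W and Jensen's inequality over all W. *)
apply: rsum_le => d _.
have := @xlnx_ge (INR (ext (d |: W))) (INR (ext W) / A) (pos_INR _).
rewrite /Rdiv ln_mult // ?ln_Rinv //; last exact: Rinv_0_lt_compat.
have iA := Rinv_0_lt_compat _ A0.
by move=> /(_ (Rmult_lt_0_compat _ _ e0 iA)); lra.
Qed.

Lemma entropy0 : entropy 0 = INR #|F| * ln (INR #|F|).
Proof.
rewrite /entropy (big_pred1 set0) => [|W]; last by rewrite cards_eq0.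
rewrite (_ : ext set0 = #|F|) //.
by apply: eq_card => X; rewrite !inE sub0set andbT.
Qed.

Lemma entropy_n : entropy n = 0.
Proof.
apply: big1 => W /eqP Wn.
have : (ext W <= 1)%N.
  apply/card_le1P => X; rewrite inE => /andP[FX sWX] Y; rewrite !inE.
  have E (Z : {set C}) : Z \in F -> W \subset Z -> Z = W.
    by move=> FZ sWZ; apply/eqP; rewrite eq_sym eqEcard sWZ Wn card_F /=.
  apply/idP/eqP=> [/andP[FY sWY]|->]; last by rewrite FX.
  by rewrite (E Y) // (E X).
by case: (ext W) => [|[|//]] _; rewrite /= ?ln_1; lra.
Qed.

(** Telescoping; (l+1) C(n, l+1) = (n-l) C(n, l) restores the normalization. Order 5 needs starting
    points other than 0. *)
Lemma entropy_ge k j : (k + j <= n)%N ->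
  entropy k / INR 'C(n, k) - INR #|F| *
    ln (\big[Rmult/1]_(i < j) mean_choices (n - (k + i))) <=
  entropy (k + j) / INR 'C(n, k + j).
Proof.
elim: j => [|j IH] kj; first by rewrite addn0 big_ord0 ln_1; lra.
have {IH} := IH ltac:(lia).
rewrite big_ord_recr /= ln_mult; last exact: mean_choices_gt0; last first.
  elim/big_ind: _ => [|x y|i _]; [lra | exact: Rmult_lt_0_compat | exact: mean_choices_gt0].
rewrite addnS; move: (k + j)%N (ltac:(lia) : (k + j < n)%N) => l lt_ln.
have := entropy_step lt_ln; set A := mean_choices _.
have b0 (i : nat) : (i <= n)%N -> 0 < INR 'C(n, i).
  by move=> i_n; apply: lt_0_INR; apply/ltP; rewrite bin_gt0.
have := b0 l (ltnW lt_ln); have := b0 l.+1 lt_ln.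
have : INR l.+1 * INR 'C(n, l.+1) = INR (n - l) * INR 'C(n, l).
  by rewrite -!mult_INR; congr INR; exact: mul_bin_left.
have : 0 < INR (n - l) by apply: lt_0_INR; lia.
have : 0 < INR l.+1 by apply: lt_0_INR; lia.
move: (INR l.+1) (INR (n - l)) (INR 'C(n, l)) (INR 'C(n, l.+1)) => l1 m B B1.
move=> l10 m0 E B10 B0 step IH.
suff H : entropy l / B - INR #|F| * ln A <= entropy l.+1 / B1.
  by move: IH H; set p := ln (bigop _ _ _);
    move: (INR #|F|) (entropy k / _) (entropy l / _) (entropy l.+1 / _) (ln A) p => *; lra.
apply: (Rmult_le_reg_l (l1 * B1)); first exact: Rmult_lt_0_compat.
rewrite (_ : _ * (entropy l.+1 / B1) = l1 * entropy l.+1); last by field; lra.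
apply: Rle_trans step; rewrite E; apply: Req_le; field; lra.
Qed.

Lemma card_le_prod :
  INR #|F| <= \big[Rmult/1]_(m < n) (1 + INR (m * m.-1) / INR (n - 2)).
Proof.
(* Factor [m] belongs to k = n - 1 - m. *)
have E : \big[Rmult/1]_(i < n) mean_choices (n - (0 + i)) =
    \big[Rmult/1]_(m < n) (1 + INR (m * m.-1) / INR (n - 2)).
  rewrite (reindex_inj rev_ord_inj) /=; apply: eq_bigr => i _.
  by rewrite add0n subKn // /mean_choices.
rewrite -E; set P := bigop _ _ _.
have P0 : 0 < P.
  rewrite /P; elim/big_ind: _ => [|x y|i _]; [lra | exact: Rmult_lt_0_compat | exact: mean_choices_gt0].
have [->|T0] := posnP #|F|; first by rewrite /=; lra.
have {}T0 : 0 < INR #|F| by apply: lt_0_INR; apply/ltP.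
have := @entropy_ge 0 n; rewrite add0n entropy0 entropy_n => /(_ (leqnn n)).
rewrite bin0 binn -/P /= /Rdiv Rinv_1 !Rmult_1_r => H.
case: (Rle_lt_dec (INR #|F|) P) => // PT.
have := Rmult_lt_compat_l _ _ _ T0 (ln_increasing _ _ P0 PT); clearbody P.
by move: H; move: (INR #|F|) (ln P) => t p H; lra.
Qed.

(* With two cells left the completion is unique. A 2-set W then has at least 3 ext W available
   cells, which bounds the integers ext W better than Jensen's inequality does. *)
Lemma card_le_order5 : n = 5%N -> (#|F| <= 23)%N.
Proof.
move=> n5.
have mcE m : mean_choices m = 1 + INR m.-1 * INR m.-2 / 3.
  by rewrite /mean_choices n5 (_ : 5 - 2 = 3)%N // -multE mult_INR /=; lra.
have nonneg (a : nat) : 0 <= INR a * ln (INR a).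
  case: a => [|a]; first by rewrite /=; lra.
  have := xlnx_ge (pos_INR a.+1) Rlt_0_1; have := pos_INR a.
  by rewrite ln_1 S_INR; lra.
have en : entropy 5 = 0 by rewrite -entropy_n n5.
(* A_3 = A_4 = 1 give [entropy 3 <= 0]; its terms are nonnegative, so a count of 2 or more is
   impossible. *)
have ext3 (V : {set C}) : #|V| = 3%N -> (ext V <= 1)%N.
  move=> V3; rewrite leqNgt; apply/negP=> e1.
  have := @entropy_ge 3 2; rewrite n5 => /(_ isT).
  rewrite en !big_ord_recl big_ord0 /= !mcE /=.
  rewrite (_ : (1 + _) * _ = 1); last lra.
  rewrite ln_1 => H.
  have {}H : entropy 3 <= 0 by move: H; rewrite /=; lra.
  have e2 : 2 <= INR (ext V) by have /leP/le_INR := e1; rewrite /=; lra.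
  have := xlnx_ge (pos_INR (ext V)) Rlt_0_1; rewrite ln_1.
  move: H; rewrite /entropy (bigD1 V) ?V3 //=.
  set s := bigop _ _ _; have : 0 <= s.
    by rewrite /s; elim/big_ind: _ => [|x y|d _]; [lra | move=> *; lra | exact: nonneg].
  by clearbody s; move: e2; move: (INR (ext V)) => e e2; move: (e * ln e) => ?; lra.
have ext2 (W : {set C}) : #|W| = 2%N -> (3 * ext W <= #|avail W|)%N.
  move=> W2; have := sum_ext_setU1 card_F confl_refl compat_F W; rewrite W2 n5 => <-.
  rewrite -sum1_card; apply: leq_sum => d; rewrite inE => /forall_inP H.
  apply: ext3; rewrite cardsU1 W2.
  by have -> // : d \notin W by apply/negP=> /H; rewrite confl_refl.
have ln2 := ln_lt_2.
(* For e = a(W), e <= 2^(e-1) gives e ln e <= ln 2 (e^2 - e), and 3 e <= M(W). Summing a(W) M(W) <=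
   50 T and a(W) = 10 T gives 50/3 - 10 = 20/3. *)
have S2 : entropy 2 <= ln 2 * (20 / 3) * INR #|F|.
  apply: (@Rle_trans _ (\big[Rplus/0]_(W : {set C} | #|W| == 2%N)
     (ln 2 / 3 * INR (ext W * #|avail W|) + - ln 2 * INR (ext W)))).
    apply: rsum_le => W /eqP W2.
    have /leP/le_INR := ext2 W W2; rewrite -!multE !mult_INR.
    have e0 := pos_INR (ext W).
    have : INR (ext W) * ln (INR (ext W)) <= INR (ext W) * (ln 2 * (INR (ext W) - 1)).
      case: (ext W) => [|a]; first by rewrite /=; lra.
      apply: Rmult_le_compat_l; first exact: pos_INR.
      elim: a => [|a IH]; first by rewrite /= ln_1; lra.
      have := pos_INR a; rewrite S_INR in IH; rewrite !S_INR => a0.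
      have : ln (INR a + 1 + 1) <= ln (2 * (INR a + 1)).
        case: (Rle_lt_or_eq_dec 0 (INR a) a0) => [p|<-]; last by right; congr ln; ring.
        by left; apply: ln_increasing; lra.
      by rewrite ln_mult; lra.
    move=> H1 H2.
    have : 0 <= INR (ext W) * ln 2 * (INR #|avail W| - INR 3 * INR (ext W)).
      by apply: Rmult_le_pos; [apply: Rmult_le_pos | ]; lra.
    by rewrite /= ; lra.
  rewrite big_split /= !rsum_mulr !rsum_INR (sum_ext1 card_F).
  have := @sum_ext_avail_le 2; rewrite n5 => /(_ isT).
  rewrite mcE (_ : 'C(5, 2) = 10%N) // -multE mult_INR multE.
  move: (INR (\sum_(_ | _) _)) (INR #|F|) => u t; rewrite /= => H.
  have : ln 2 * (50 * t - u) >= 0 by apply: Rle_ge; apply: Rmult_le_pos; lra.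
  by lra.
have [->|T0] := posnP #|F|; first by [].
have {}T0 : 0 < INR #|F| by apply: lt_0_INR; apply/ltP.
(* Here A_0 A_1 = 5 * 3 = 15. *)
have := @entropy_ge 0 2; rewrite entropy0 n5 => /(_ isT).
rewrite bin0 add0n (_ : 'C(5, 2) = 10%N) // !big_ord_recl big_ord0 /= !mcE /=.
rewrite (_ : (1 + _) * _ = 15); last lra.
move=> H.
have {}H : INR #|F| * (3 * ln (INR #|F|)) <= INR #|F| * (3 * ln 15 + 2 * ln 2).
  move: H S2; move: (INR #|F|) (entropy 2) (ln 15) => t e l15.
  by move: (ln t) (ln 2) => lt l2; lra.
have {}H := Rmult_le_reg_l _ _ _ T0 H.
rewrite leqNgt; apply/negP=> /leP/le_INR.
rewrite (_ : INR 24 = 24) => [T24|]; last by rewrite /=; lra.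
have cube x : 0 < x -> ln (x * x * x) = 3 * ln x.
  by move=> x0; rewrite !ln_mult //; [lra | exact: Rmult_lt_0_compat].
(* T^3 <= 4 * 15^3 = 13500, below 24^3 = 13824. *)
have : ln (15 * 15 * 15 * (2 * 2)) < ln (24 * 24 * 24) by apply: ln_increasing; lra.
rewrite ln_mult; [|lra|lra]; rewrite (ln_mult 2); [|lra|lra].
rewrite !cube; [|lra|lra].
have : ln 24 <= ln (INR #|F|).
  by case: T24 => [p|->]; [left; apply: ln_increasing p; lra | right].
by move: H; move: (ln (INR _)) (ln 15) (ln 2) (ln 24) => f l15 l2 l24; lra.
Qed.

End Entropy.

(** * Transversals of a Latin square as such a family *)

Section Latin.
Variables (n : nat) (L : {ffun 'I_n * 'I_n -> 'I_n}).
Hypothesis latin : latin_square L.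

Let confl (c d : 'I_n * 'I_n) := [|| c.1 == d.1, c.2 == d.2 | L c == L d].

Lemma latin_row i j j' : L (i, j) = L (i, j') -> j = j'.
Proof.
move=> E; have /andP[/forallP/(_ i)/forallP/(_ (L (i, j)))/cards1P[x]] := latin.
move=> /setP H _; have := H j; have := H j'.
by rewrite !inE E eqxx => /esym/eqP-> /esym/eqP->.
Qed.

Lemma latin_col i i' j : L (i, j) = L (i', j) -> i = i'.
Proof.
move=> E; have /andP[_ /forallP/(_ j)/forallP/(_ (L (i, j)))/cards1P[x]] := latin.
move=> /setP H; have := H i; have := H i'.
by rewrite !inE E eqxx => /esym/eqP-> /esym/eqP->.
Qed.

Lemma transversal_compat X : transversal L X ->
  {in X &, forall c d, confl c d -> c = d}.
Proof.
move=> /and4P[_ /forallP rows /forallP cols /forall_inP syms] c d Xc Xd.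
case/or3P=> E.
- have /cards1P[x /setP H] := rows c.1; have := H c; have := H d.
  by rewrite !inE Xc Xd (eqP E) eqxx => /esym/eqP-> /esym/eqP->.
- have /cards1P[x /setP H] := cols c.2; have := H c; have := H d.
  by rewrite !inE Xc Xd (eqP E) eqxx => /esym/eqP-> /esym/eqP->.
- by have /forall_inP/(_ d Xd)/implyP/(_ E)/eqP := syms c Xc.
Qed.

(** The cells of [X] sharing the row, the column and the symbol of [d] are distinct: a cell sharing
    two of these is [d] itself. *)
Lemma transversal_confl X d : transversal L X -> d \notin X ->
  (2 < #|[set c in X | confl c d]|)%N.
Proof.
move=> tX; have compat := transversal_compat tX.
move: (tX) => /and4P[/eqP cX /forallP rows /forallP cols _] nXd.
have [r /setP/(_ r)] := cards1P (rows d.1); rewrite !inE eqxx => /andP[Xr rd].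
have [k /setP/(_ k)] := cards1P (cols d.2); rewrite !inE eqxx => /andP[Xk kd].
have injL : {in X &, injective L} by move=> x y Xx Xy E; apply: compat; rewrite // /confl E eqxx !orbT.
have /imsetP[s Xs Es] : L d \in L @: X.
  suff -> : L @: X = setT by rewrite inE.
  by apply/eqP; rewrite eqEcard subsetT cardsT card_ord card_in_imset // cX leqnn.
have rk : r != k.
  apply: contraNneq nXd => E; suff -> : d = r by [].
  by rewrite (surjective_pairing d) (surjective_pairing r) -(eqP rd) -(eqP kd) E.
have rs : r != s.
  apply: contraNneq nXd => E; suff -> : d = s by [].
  move: Es rd; rewrite E; case: (d) (s) => [i j] [i' j'] /= Es /eqP e.
  by move: Es; rewrite e => /latin_row->.
have ks : k != s.
  apply: contraNneq nXd => E; suff -> : d = s by [].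
  move: Es kd; rewrite E; case: (d) (s) => [i j] [i' j'] /= Es /eqP e.
  by move: Es; rewrite e => /latin_col->.
have <- : #|[set r; k; s]| = 3%N.
  by rewrite -setUA cardsU1 cards2 !inE negb_or rk rs ks.
apply: subset_leq_card; apply/subsetP=> x; rewrite !inE /confl -orbA => /or3P[]/eqP->.
- by rewrite Xr rd.
- by rewrite Xk kd orbT.
- by rewrite Xs Es eqxx !orbT.
Qed.

Let trans_card X : X \in [set X | transversal L X] -> #|X| = n.
Proof. by rewrite inE => /and4P[/eqP]. Qed.
Let confl_refl c : confl c c.
Proof. by rewrite /confl eqxx. Qed.
Let trans_compat X : X \in [set X | transversal L X] ->
  {in X &, forall c d, confl c d -> c = d}.
Proof. by rewrite inE; exact: transversal_compat. Qed.
Let trans_confl X d : X \in [set X | transversal L X] -> d \notin X ->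
  (2 < #|[set c in X | confl c d]|)%N.
Proof. by rewrite inE; exact: transversal_confl. Qed.
Let card_cells : #|{: 'I_n * 'I_n}| = (n * n)%N.
Proof. by rewrite card_prod card_ord. Qed.

Lemma num_transversals_le : (2 < n)%N ->
  INR (num_transversals L) <= \big[Rmult/1]_(m < n) (1 + INR (m * m.-1) / INR (n - 2)).
Proof. exact: card_le_prod trans_card confl_refl trans_compat trans_confl card_cells. Qed.

Lemma num_transversals_order5 : n = 5%N -> (num_transversals L <= 23)%N.
Proof.
move=> n5; have n3 : (2 < n)%N by rewrite n5.
exact: card_le_order5 trans_card confl_refl trans_compat trans_confl card_cells n3 n5.
Qed.

End Latin.

End Entropy.

(** * Estimates for the entropy bound *)

Open Scope R_scope.

(** For N = n - 2 and k = n this is the product of the A_k. A separate [N] can grow with the number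
    of factors fixed. *)
Fixpoint step_prod (N : R) (k : nat) : R :=
  match k with
  | O => 1
  | S j => step_prod N j * (1 + INR (j * (j - 1)) / N)
  end.

Fixpoint step_sum (N : R) (k : nat) : R :=
  match k with
  | O => 0
  | S j => step_sum N j + / (N + INR (j * (j - 1)))
  end.

Lemma step_prod_pos N k : 0 < N -> 0 < step_prod N k.
Proof.
  intros HN; induction k as [|k IH]; simpl; [lra|].
  apply Rmult_lt_0_compat; [exact IH|].
  pose proof (pos_INR (k * (k - 1))).
  pose proof (Rmult_le_pos _ _ H (Rlt_le _ _ (Rinv_0_lt_compat _ HN))).
  unfold Rdiv; lra.
Qed.

(** With q = j(j-1), the factors at N + 1 and N have ratio (1 + 1/(N+q)) (1 - 1/(N+1)); then 1 + x
    <= e^x is applied twice. *)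
Lemma step_prod_succ N k : 0 < N ->
  step_prod (N + 1) k <= step_prod N k * exp (step_sum N k - INR k / (N + 1)).
Proof.
  intros HN; induction k as [|k IH].
  - simpl. replace (0 - 0 / (N + 1)) with 0 by (field; lra). rewrite exp_0; lra.
  - rewrite S_INR; cbn [step_prod step_sum].
    set (q := INR (k * (k - 1))).
    assert (Hq : 0 <= q) by apply pos_INR.
    replace (step_sum N k + / (N + q) - (INR k + 1) / (N + 1))
      with ((step_sum N k - INR k / (N + 1)) + (/ (N + q) + - / (N + 1))) by (field; lra).
    rewrite !exp_plus.
    pose proof (exp_ineq1_le (/ (N + q))) as E1.
    pose proof (exp_ineq1_le (- / (N + 1))) as E2.
    pose proof (step_prod_pos (N + 1) k ltac:(lra)).
    assert (F : 1 + q / (N + 1) <= (1 + q / N) * (exp (/ (N + q)) * exp (- / (N + 1)))).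
    { replace (1 + q / (N + 1)) with ((1 + q / N) * ((1 + / (N + q)) * (1 + - / (N + 1))))
        by (field; lra).
      pose proof (Rinv_0_lt_compat (N + q) ltac:(lra)).
      assert (/ (N + 1) < 1) by (rewrite <- Rinv_1; apply Rinv_lt_contravar; lra).
      pose proof (Rmult_le_pos _ _ Hq (Rlt_le _ _ (Rinv_0_lt_compat _ HN))).
      apply Rmult_le_compat_l; [unfold Rdiv; lra|].
      apply Rmult_le_compat; lra. }
    replace (step_prod N k * (1 + q / N) * (exp (step_sum N k - INR k / (N + 1)) *
       (exp (/ (N + q)) * exp (- / (N + 1)))))
      with (step_prod N k * exp (step_sum N k - INR k / (N + 1)) *
        ((1 + q / N) * (exp (/ (N + q)) * exp (- / (N + 1))))) by ring.
    apply Rmult_le_compat; try lra.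
    pose proof (Rmult_le_pos _ _ Hq (Rlt_le _ _ (Rinv_0_lt_compat (N + 1) ltac:(lra)))).
    unfold Rdiv; lra.
Qed.

(** From index 9 on, 1/(k(k-1)) = 1/(k-1) - 1/k telescopes. *)
Lemma step_sum_tail N k : 0 < N -> (9 <= k)%nat ->
  step_sum N k <= step_sum N 9 + / 8 - / INR (k - 1).
Proof.
  intros HN Hk; induction Hk as [|k Hk IH].
  - replace (INR (9 - 1)) with 8 by (simpl; lra). lra.
  - change (step_sum N (S k)) with (step_sum N k + / (N + INR (k * (k - 1)))).
    replace (S k - 1)%nat with k by lia.
    set (x := INR (k - 1)) in *.
    assert (Hx : 8 <= x).
    { unfold x; replace 8 with (INR 8) by (simpl; lra); apply le_INR; lia. }
    assert (Ex : INR k = x + 1).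
    { unfold x; rewrite <- S_INR; f_equal; lia. }
    rewrite mult_INR, Ex; fold x.
    assert (/ (N + (x + 1) * x) <= / ((x + 1) * x)).
    { apply Rinv_le_contravar; nra. }
    replace (/ ((x + 1) * x)) with (/ x - / (x + 1)) in H by (field; lra).
    lra.
Qed.

Lemma step_sum_le N k : 14 <= N -> (9 <= k)%nat -> step_sum N k <= 504 / 1000.
Proof.
  intros HN Hk.
  pose proof (step_sum_tail N k ltac:(lra) Hk).
  assert (0 < / INR (k - 1)) by (apply Rinv_0_lt_compat, lt_0_INR; lia).
  assert (step_sum N 9 <= step_sum 14 9).
  { clear - HN; generalize 9%nat; intros k; induction k as [|k IH]; cbn [step_sum]; [lra|].
    pose proof (pos_INR (k * (k - 1))).
    apply Rplus_le_compat; [exact IH|]; apply Rinv_le_contravar; lra. }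
  assert (step_sum 14 9 <= 379 / 1000) by (simpl; lra).
  lra.
Qed.

(** * Rational estimates of the constant c *)

Lemma exp_pow x n : exp x ^ n = exp (INR n * x).
Proof.
  induction n as [|n IH]; [simpl; rewrite Rmult_0_l, exp_0; reflexivity|].
  rewrite S_INR; cbn [pow]; rewrite IH, <- exp_plus; f_equal; ring.
Qed.

Lemma exp_ge_pow64 x : 0 <= x -> (1 + x / 64) ^ 64 <= exp x.
Proof.
  intros Hx; replace (exp x) with (exp (x / 64) ^ 64).
  - apply pow_incr; pose proof (exp_ineq1_le (x / 64)); lra.
  - rewrite exp_pow; f_equal; replace (INR 64) with 64 by (simpl; lra); field.
Qed.

Definition growth := sqrt ((3 - sqrt 3) / 6) * exp (sqrt 3 / 6).

Lemma sqrt3_bounds : 1732 / 1000 <= sqrt 3 <= 17321 / 10000.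
Proof.
  pose proof (sqrt_pos 3); pose proof (sqrt_sqrt 3 ltac:(lra)); nra.
Qed.

Lemma growth_pos : 0 < growth.
Proof.
  pose proof sqrt3_bounds.
  apply Rmult_lt_0_compat; [apply sqrt_lt_R0; lra | apply exp_pos].
Qed.

(** Six squarings, each rounded down to a short decimal, avoid expanding a large power. *)
Lemma pow64_ge x a b c d e f : 0 <= a -> 0 <= b -> 0 <= c -> 0 <= d -> 0 <= e ->
  a <= x * x -> b <= a * a -> c <= b * b -> d <= c * c -> e <= d * d -> f <= e * e ->
  f <= x ^ 64.
Proof.
  intros Ha Hb Hc Hd He H1 H2 H3 H4 H5 H6.
  replace (x ^ 64) with ((x * x) ^ 32) by ring.
  apply Rle_trans with (a ^ 32); [|apply pow_incr; lra].
  replace (a ^ 32) with ((a * a) ^ 16) by ring.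
  apply Rle_trans with (b ^ 16); [|apply pow_incr; lra].
  replace (b ^ 16) with ((b * b) ^ 8) by ring.
  apply Rle_trans with (c ^ 8); [|apply pow_incr; lra].
  replace (c ^ 8) with ((c * c) ^ 4) by ring.
  apply Rle_trans with (d ^ 4); [|apply pow_incr; lra].
  replace (d ^ 4) with ((d * d) ^ 2) by ring.
  apply Rle_trans with (e ^ 2); [|apply pow_incr; lra].
  simpl; lra.
Qed.

(** A rational stand-in for c^2, which is about 0.3764. *)
Lemma growth_sq : 3 / 8 <= growth * growth.
Proof.
  pose proof sqrt3_bounds.
  unfold growth.
  replace (sqrt ((3 - sqrt 3) / 6) * exp (sqrt 3 / 6) * (sqrt ((3 - sqrt 3) / 6) * exp (sqrt 3 / 6)))
    with (sqrt ((3 - sqrt 3) / 6) * sqrt ((3 - sqrt 3) / 6) * (exp (sqrt 3 / 6) * exp (sqrt 3 / 6))) by ring.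
  rewrite sqrt_sqrt, <- exp_plus by lra.
  assert (1775 / 1000 <= exp (sqrt 3 / 6 + sqrt 3 / 6)).
  { eapply Rle_trans; [|apply exp_ge_pow64; lra].
    (* 1.00902 is below 1 + sqrt 3 / 192. *)
    apply Rle_trans with ((100902 / 100000) ^ 64); [|apply pow_incr; lra].
    apply (pow64_ge (100902 / 100000) (101810 / 100000) (103652 / 100000) (107437 / 100000)
      (115427 / 100000) (133233 / 100000)); lra. }
  apply Rle_trans with ((3 - 17321 / 10000) / 6 * (1775 / 1000)); [lra|].
  apply Rmult_le_compat; lra.
Qed.

(** 0.496 = 1 - 0.504, with 0.504 from [step_sum_le]. *)
Lemma exp_growth : exp (- (496 / 1000)) <= growth.
Proof.
  apply Rsqr_incr_0; [|left; apply exp_pos | left; exact growth_pos].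
  unfold Rsqr; rewrite <- exp_plus.
  apply Rle_trans with (3 / 8); [|exact growth_sq].
  replace (- (496 / 1000) + - (496 / 1000)) with (- (992 / 1000)) by lra.
  rewrite exp_Ropp; replace (3 / 8) with (/ (8 / 3)) by lra.
  apply Rinv_le_contravar; [lra|].
  apply Rle_trans with (2 := exp_ge_pow64 (992 / 1000) ltac:(lra)).
  apply (pow64_ge (1 + 992 / 1000 / 64) (10312 / 10000) (10633 / 10000) (11306 / 10000)
    (12782 / 10000) (16337 / 10000)); lra.
Qed.

Definition bound n := growth ^ n * sqrt (INR n) * INR (fact n).

(** Squaring removes the roots, and 3/8 replaces c^2, leaving a rational inequality. *)
Lemma le_bound n x : 0 <= x ->
  x * x * 8 ^ n <= 3 ^ n * INR n * (INR (fact n) * INR (fact n)) -> x <= bound n.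
Proof.
  intros Hx H.
  pose proof growth_pos.
  pose proof (pow_lt _ n H0).
  assert (F : 0 <= INR (fact n)) by apply pos_INR.
  assert (S : 0 <= sqrt (INR n)) by apply sqrt_pos.
  apply Rsqr_incr_0; [| exact Hx | unfold bound; repeat apply Rmult_le_pos; lra].
  unfold Rsqr, bound.
  replace (growth ^ n * sqrt (INR n) * INR (fact n) * (growth ^ n * sqrt (INR n) * INR (fact n)))
    with ((growth ^ n * growth ^ n) * ((sqrt (INR n) * sqrt (INR n)) * (INR (fact n) * INR (fact n)))) by ring.
  rewrite sqrt_sqrt by apply pos_INR.
  rewrite <- Rpow_mult_distr.
  apply Rle_trans with ((3 / 8) ^ n * (INR n * (INR (fact n) * INR (fact n)))).
  - assert (0 < 8 ^ n) by (apply pow_lt; lra).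
    unfold Rdiv; rewrite Rpow_mult_distr, pow_inv.
    apply Rmult_le_reg_r with (8 ^ n); [assumption|].
    replace (3 ^ n * / 8 ^ n * (INR n * (INR (fact n) * INR (fact n))) * 8 ^ n)
      with (3 ^ n * INR n * (INR (fact n) * INR (fact n))) by (field; lra).
    exact H.
  - apply Rmult_le_compat_r.
    + repeat apply Rmult_le_pos; try assumption; apply pos_INR.
    + apply pow_incr; pose proof growth_sq; lra.
Qed.

Lemma bound_succ n : growth * (INR n + 1) * bound n <= bound (S n).
Proof.
  pose proof growth_pos; pose proof (pow_lt _ n H).
  unfold bound; rewrite fact_simpl, mult_INR, S_INR; simpl pow.
  assert (sqrt (INR n) <= sqrt (INR n + 1)) by (apply sqrt_le_1_alt; lra).
  pose proof (pos_INR (fact n)); pose proof (pos_INR n); pose proof (sqrt_pos (INR n)).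
  replace (growth * (INR n + 1) * (growth ^ n * sqrt (INR n) * INR (fact n)))
    with (growth * growth ^ n * ((INR n + 1) * INR (fact n)) * sqrt (INR n)) by ring.
  replace (growth * growth ^ n * sqrt (INR n + 1) * ((INR n + 1) * INR (fact n)))
    with (growth * growth ^ n * ((INR n + 1) * INR (fact n)) * sqrt (INR n + 1)) by ring.
  apply Rmult_le_compat_l; [|assumption].
  apply Rmult_le_pos; [|apply Rmult_le_pos; lra].
  left; apply Rmult_lt_0_compat; assumption.
Qed.

(** * Exact integer check of small orders *)

Fixpoint step_prodZ (N : Z) (k : nat) : Z :=
  match k with
  | O => 1
  | S j => step_prodZ N j * (N + Z.of_nat (j * (j - 1)))
  end.

Lemma step_prodZ_eq N k : (0 < N)%Z -> step_prod (IZR N) k * IZR N ^ k = IZR (step_prodZ N k).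
Proof.
  intros HN%IZR_lt; induction k as [|k IH]; cbn [step_prod step_prodZ pow]; [lra|].
  rewrite mult_IZR, plus_IZR, <- INR_IZR_INZ, <- IH; field; lra.
Qed.

Fixpoint factZ (k : nat) : Z :=
  match k with
  | O => 1
  | S j => Z.of_nat (S j) * factZ j
  end.

Lemma factZ_eq k : IZR (factZ k) = INR (fact k).
Proof.
  induction k as [|k IH]; [reflexivity|].
  cbn [factZ]; rewrite fact_simpl, mult_INR, mult_IZR, IH, <- INR_IZR_INZ; reflexivity.
Qed.

(** The hypothesis of [le_bound] multiplied by N^(2n). It is false for n = 5, where the product is
    25. *)
Definition small_check (n : nat) : bool :=
  let N := (Z.of_nat n - 2)%Z in let F := factZ n in
  let P := step_prodZ N n in let q := (N ^ Z.of_nat n)%Z in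
  (P * P * 8 ^ Z.of_nat n <=? 3 ^ Z.of_nat n * Z.of_nat n * (F * F) * (q * q))%Z.

Lemma small_check_bound n : (2 < n)%nat -> small_check n = true ->
  step_prod (INR n - 2) n <= bound n.
Proof.
  intros Hn H.
  assert (EN : INR n - 2 = IZR (Z.of_nat n - 2)) by (rewrite minus_IZR, INR_IZR_INZ; reflexivity).
  assert (HN : (0 < Z.of_nat n - 2)%Z) by lia.
  pose proof (step_prodZ_eq _ n HN) as EP; rewrite <- EN in EP.
  pose proof (IZR_lt _ _ HN) as HN'; rewrite <- EN in HN'.
  apply le_bound; [left; apply step_prod_pos; exact HN'|].
  unfold small_check in H; apply Zle_bool_imp_le, IZR_le in H.
  rewrite !mult_IZR, <- !pow_IZR, factZ_eq, <- EP, <- EN, <- INR_IZR_INZ in H.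
  pose proof (pow_lt _ n HN') as Q.
  apply Rmult_le_reg_r with ((INR n - 2) ^ n * (INR n - 2) ^ n); [apply Rmult_lt_0_compat; exact Q|].
  eapply Rle_trans; [|exact H]; right; ring.
Qed.

Lemma step_prod_le_bound n : (6 <= n)%nat -> step_prod (INR n - 2) n <= bound n.
Proof.
  intros Hn; destruct (le_lt_dec n 16) as [H16|H16].
  - apply small_check_bound; [lia|].
    do 6 (destruct n as [|n]; [lia|]).
    do 11 (destruct n as [|n]; [vm_compute; reflexivity|]); lia.
  - assert (H : (16 <= n)%nat) by lia; clear Hn H16.
    induction H as [|n H IH].
    + apply small_check_bound; [lia|vm_compute; reflexivity].
    + assert (Hn : 16 <= INR n) by (replace 16 with (INR 16) by (simpl; lra); apply le_INR; exact H).
      apply Rle_trans with (2 := bound_succ n).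
      cbn [step_prod]; rewrite S_INR.
      replace (INR n + 1 - 2) with (INR n - 2 + 1) by lra.
      (* The new last factor is exactly n + 1, as in [bound_succ]. *)
      replace (1 + INR (n * (n - 1)) / (INR n - 2 + 1)) with (INR n + 1)
        by (rewrite mult_INR, minus_INR by lia; simpl (INR 1); field; lra).
      pose proof (step_prod_succ (INR n - 2) n ltac:(lra)) as E.
      pose proof (step_sum_le (INR n - 2) n ltac:(lra) ltac:(lia)) as E2.
      (* Hence the exponent is at most 0.504 - 1. *)
      assert (1 <= INR n / (INR n - 2 + 1)).
      { apply Rmult_le_reg_r with (INR n - 2 + 1); [lra|].
        unfold Rdiv; rewrite Rmult_assoc, Rinv_l; lra. }
      assert (exp (step_sum (INR n - 2) n - INR n / (INR n - 2 + 1)) <= growth).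
      { apply Rle_trans with (2 := exp_growth).
        destruct (Req_dec (step_sum (INR n - 2) n - INR n / (INR n - 2 + 1)) (- (496 / 1000))) as [->|D];
          [lra|left; apply exp_increasing; lra]. }
      pose proof (step_prod_pos (INR n - 2) n ltac:(lra)).
      pose proof growth_pos.
      assert (step_prod (INR n - 2 + 1) n <= bound n * growth).
      { eapply Rle_trans; [exact E|].
        apply Rmult_le_compat; try lra. left; apply exp_pos. }
      replace (growth * (INR n + 1) * bound n) with ((bound n * growth) * (INR n + 1)) by ring.
      apply Rmult_le_compat_r; lra.
Qed.

(** The bound is about 23.3, so 23 is the largest count it allows. *)
Lemma order5_bound : 23 <= bound 5.
Proof. apply le_bound; simpl; lra. Qed.

(** * The two bounds *)

Module Bounds.
Import all_boot zify Defs Entropy.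
Set Implicit Arguments. Unset Strict Implicit. Unset Printing Implicit Defensive.

Lemma T_lower n : (5 <= n)%N -> Rpower 15 (INR n / 5) <= INR (T n).
Proof.
move=> /SmallOrders.good_order_ge5[K /Tables.table_with_le_T KT K5].
apply: (@Rle_trans _ (INR K)); last by apply: le_INR; apply/leP.
have K0 : 0 < INR K.
  apply: lt_0_INR; apply/ltP; case: (K) K5 => //.
  by rewrite exp0n // leqn0 expn_eq0.
have powE (a b : nat) : INR (a ^ b) = INR a ^ b.
  by elim: b => // b IH; rewrite expnS -multE mult_INR IH.
have : INR 15 ^ n <= INR K ^ 5 by rewrite -!powE; apply: le_INR; apply/leP.
rewrite (_ : INR 15 = 15) => [K5R|]; last by rewrite /=; lra.
rewrite -[INR K in X in _ <= X]exp_ln // /Rpower.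
have : ln (15 ^ n) <= ln (INR K ^ 5).
  case: K5R => [lt|->]; last by right.
  by left; apply: ln_increasing => //; apply: pow_lt; lra.
rewrite !ln_pow //; last by lra.
rewrite (_ : INR 5 = 5); last by rewrite /=; lra.
move=> le; have {le} : INR n / 5 * ln 15 <= ln (INR K) by lra.
by case=> [lt|->]; [left; exact: exp_increasing | right].
Qed.

Lemma prod_step_prod N k :
  \big[Rmult/1]_(m < k) (1 + INR (m * m.-1) / N) = step_prod N k.
Proof.
elim: k => [|k IH]; first by rewrite big_ord0.
by rewrite big_ord_recr /= IH -subn1.
Qed.

Lemma T_upper n : (5 <= n)%N -> INR (T n) <= bound n.
Proof.
move=> n5; rewrite /T; elim/big_ind: _ => [|x y xB yB|L latin].
(* The default value 0 of the maximum. *)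
- rewrite /bound; apply: Rmult_le_pos; last exact: pos_INR.
  by apply: Rmult_le_pos; [apply: pow_le; left; exact: growth_pos | exact: sqrt_pos].
- by rewrite /maxn; case: ifP.
have [E|ne5] := eqVneq n 5%N.
  apply: (@Rle_trans _ (INR 23)).
    by apply: le_INR; apply/leP; exact: Entropy.num_transversals_order5.
  by rewrite {}E (_ : INR 23 = 23); [exact: order5_bound | rewrite /=; lra].
apply: Rle_trans (step_prod_le_bound n _); last by apply/leP; lia.
rewrite -prod_step_prod (_ : INR n - 2 = INR (n - 2)).
  by apply: Entropy.num_transversals_le => //; lia.
by rewrite -minusE minus_INR; [rewrite /=; lra | apply/leP; lia].
Qed.

End Bounds.

Theorem theorem3p1 (n : nat) (hn : (5 <= n)%nat) :
  Rpower 15 (INR n / 5) <= INR (T n) /\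
  INR (T n) <= (sqrt ((3 - sqrt 3) / 6) * exp (sqrt 3 / 6)) ^ n
                 * sqrt (INR n) * INR (Factorial.fact n).
Proof.
  assert (H : is_true (ssrnat.leq 5 n)) by exact (ssrbool.introT ssrnat.leP hn).
  exact (conj (Bounds.T_lower H) (Bounds.T_upper H)).
Qed.
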